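(* The following decision problem is undecidable: given a determined matrix multiplication game $(\mathcal{A},\mathcal{E})$, where $\mathcal{A}$ and $\mathcal{E}$ are finite sets of non-negative matrices with rational elements, and given $\alpha\in\mathbb{Q}_+$, decide whether the value $V$ of the game satisfies $V\le\alpha$.
   Context: Matrix multiplication game (MMG) $(\mathcal{A},\mathcal{E})$: here $\mathcal{A}$ is a nonempty set of $(M\times N)$-matrices and $\mathcal{E}$ a nonempty set of $(N\times M)$-matrices. For $i=1,2,\dots$ Adam writes $A_i\in\mathcal{A}$ and then Eve writes $E_i\in\mathcal{E}$. A strategy for Adam is a function $\sigma:(\mathcal{A}\cdot\mathcal{E})^*\to\mathcal{A}$ mapping every finite history to his next move; a strategy for Eve is a function $\tau:(\mathcal{A}\cdot\mathcal{E})^*\cdot\mathcal{A}\to\mathcal{E}$. A pair $(\sigma,\tau)$ determines a unique play $A_1E_1A_2E_2\cdots$, with payoff $P(\sigma,\tau)=\limsup_{k\to\infty}\|A_1E_1\cdots A_kE_k\|^{1/k}$, where $\|\cdot\|$ is the entrywise $1$-norm. Adam minimizes and Eve maximizes the payoff. The game is determined with value $V$ if $\inf_\sigma\sup_\tau P(\sigma,\tau)=\sup_\tau\inf_\sigma P(\sigma,\tau)=V$. $\mathbb{Q}_+$ is the set of positive rationals. Undecidability is meant for the problem restricted to inputs for which the game is determined: no algorithm answers correctly on all such inputs. *)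

(* Defs.v *)
From HB Require Import structures.
From mathcomp Require Import all_boot all_order all_algebra.
From mathcomp Require Import all_classical all_reals all_analysis.

Set Implicit Arguments.
Unset Strict Implicit.
Unset Printing Implicit Defensive.

Import Order.TTheory GRing.Theory Num.Theory.
Import numFieldNormedType.Exports.

Local Open Scope classical_set_scope.
Local Open Scope ring_scope.

(** * Register machines *)

(** A program is a list of instructions acting on registers indexed by [nat].
    [Inc r] increments register [r] and falls through; [Dec r j] jumps to [j]
    when register [r] is zero, and otherwise decrements it and falls through.
    The machine halts when the program counter leaves the program. *)
Inductive instr : Type :=
| Inc of nat
| Dec of nat & nat.

Definition program : Type := seq instr.

Definition config : Type := (nat * (nat -> nat))%type.

Definition set_reg (f : nat -> nat) (r v : nat) : nat -> nat :=
  fun s => if s == r then v else f s.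

Definition step (P : program) (c : config) : config :=
  let: (pc, f) := c in
  match onth P pc with
  | None => c
  | Some (Inc r) => (pc.+1, set_reg f r (f r).+1)
  | Some (Dec r j) =>
      if f r == 0%N then (j, f) else (pc.+1, set_reg f r (f r).-1)
  end.

Definition halted (P : program) (c : config) : bool := (size P <= c.1)%N.

(** The input is placed in register 0, all other registers being empty, and
    the output is read in register 0. *)
Definition init_config (x : nat) : config :=
  (0%N, fun r => if r == 0%N then x else 0%N).

Definition computes (P : program) (x y : nat) : Prop :=
  exists k : nat, let c := iter k (step P) (init_config x) in
    halted P c /\ c.2 0%N = y.

(** Nothing is required of [P], not even termination, off the promise. *)
Definition decides (P : program) (I : Type) (enc : I -> nat)
    (promise question : I -> Prop) : Prop :=
  forall x : I, promise x ->
    (question x -> computes P (enc x) 1) /\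
    (~ question x -> computes P (enc x) 0).

Definition undecidable (I : Type) (enc : I -> nat)
    (promise question : I -> Prop) : Prop :=
  ~ exists P : program, decides P enc promise question.

(** * Matrix multiplication games *)

Definition norm1 (R : realType) (m n : nat) (X : 'M[R]_(m, n)) : R :=
  \sum_(i < m) \sum_(j < n) `|X i j|.

Section Game.
Variables (R : realType) (M N : nat).
Variables (A : set 'M[R]_(M, N)) (E : set 'M[R]_(N, M)).

(** A history in [(A . E)^*] is the list of the rounds played so far, oldest
    first; a set used as a type is the subtype of its elements. *)
Definition history : Type := seq (A * E).

Definition adam_strategy : Type := history -> A.

Definition eve_strategy : Type := history -> A -> E.

Fixpoint play (sigma : adam_strategy) (tau : eve_strategy) (k : nat)
    : history :=
  if k is k'.+1 then
    let h := play sigma tau k' in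
    let a := sigma h in rcons h (a, tau h a)
  else [::].

Definition history_prod (h : history) : 'M[R]_M :=
  \prod_(r <- h) (set_val r.1 *m set_val r.2).

(** The [k]-th term of the sequence is the one for [k.+1] rounds. *)
Definition payoff (sigma : adam_strategy) (tau : eve_strategy) : \bar R :=
  limn_esup (fun k : nat =>
    (norm1 (history_prod (play sigma tau k.+1)) `^ (k.+1%:R)^-1)%:E).

Definition upper_value : \bar R :=
  ereal_inf [set ereal_sup [set payoff sigma tau | tau in [set: eve_strategy]]
            | sigma in [set: adam_strategy]].

Definition lower_value : \bar R :=
  ereal_sup [set ereal_inf [set payoff sigma tau | sigma in [set: adam_strategy]]
            | tau in [set: eve_strategy]].

Definition determined_with_value (V : \bar R) : Prop :=
  upper_value = V /\ lower_value = V.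

Definition determined : Prop := exists V : \bar R, determined_with_value V.

End Game.

(** * Instances of the decision problem *)

(** The two finite sets are presented by lists of their elements. *)
Record mmg_instance : Type := MMGInstance {
  nrows : nat;
  ncols : nat;
  adam_matrices : seq 'M[rat]_(nrows, ncols);
  eve_matrices : seq 'M[rat]_(ncols, nrows);
  threshold : rat
}.

Definition real_mxset (R : realType) (m n : nat) (s : seq 'M[rat]_(m, n))
    : set 'M[R]_(m, n) :=
  [set map_mx ratr X | X in [set` s]].
Arguments real_mxset R {m n} s _.

Definition adam_set (R : realType) (x : mmg_instance) :=
  real_mxset R (adam_matrices x).
Arguments adam_set R x _ : clear implicits.

Definition eve_set (R : realType) (x : mmg_instance) :=
  real_mxset R (eve_matrices x).
Arguments eve_set R x _ : clear implicits.

Definition nonneg_mx (m n : nat) (X : 'M[rat]_(m, n)) : Prop :=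
  forall i j, 0 <= X i j.

Definition admissible (R : realType) (x : mmg_instance) : Prop :=
  [/\ (0 < nrows x)%N /\ (0 < ncols x)%N,
      adam_matrices x <> [::] /\ eve_matrices x <> [::],
      (forall X, X \in adam_matrices x -> nonneg_mx X) /\
      (forall X, X \in eve_matrices x -> nonneg_mx X),
      0 < threshold x &
      determined (adam_set R x) (eve_set R x)].

Definition value_le_threshold (R : realType) (x : mmg_instance) : Prop :=
  exists2 V : \bar R, determined_with_value (adam_set R x) (eve_set R x) V &
    (V <= (ratr (threshold x))%:E)%E.

(** Goedel numbering of instances, based on the bijection
    [CodeSeq.code : seq nat -> nat]. Matrices are read row by row and a
    rational is given by its sign, numerator and denominator. *)
Definition rat_code (q : rat) : nat :=
  CodeSeq.code [:: nat_of_bool (q < 0); `|numq q|%N; `|denq q|%N].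

Definition mx_code (m n : nat) (X : 'M[rat]_(m, n)) : nat :=
  CodeSeq.code [seq CodeSeq.code [seq rat_code (X i j) | j <- enum 'I_n]
               | i <- enum 'I_m].

Definition mmg_code (x : mmg_instance) : nat :=
  CodeSeq.code [:: nrows x; ncols x;
    CodeSeq.code [seq mx_code X | X <- adam_matrices x];
    CodeSeq.code [seq mx_code X | X <- eve_matrices x];
    rat_code (threshold x)].

Lemma rat_code_inj : injective rat_code.
Proof.
move=> p q /(can_inj CodeSeq.codeK) [Hs Hn Hd].
have Hsg : (p < 0) = (q < 0) by move: Hs; do 2 case: (_ < 0).
have dpq : denq p = denq q.
  by rewrite -[denq p]gez0_abs ?denq_ge0 // -[denq q]gez0_abs ?denq_ge0 // Hd.
have npq : numq p = numq q.
  by rewrite [numq p]intEsign [numq q]intEsign !numq_lt0 Hsg Hn.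
by rewrite -[p]divq_num_den -[q]divq_num_den npq dpq.
Qed.

Lemma mx_code_inj (m n : nat) : injective (@mx_code m n).
Proof.
move=> X Y /(can_inj CodeSeq.codeK) /eq_in_map XY; apply/matrixP => i j.
have /(can_inj CodeSeq.codeK) /eq_in_map := XY i (mem_enum _ i).
by move=> /(_ j (mem_enum _ j)) /rat_code_inj.
Qed.

Lemma mmg_code_inj : injective mmg_code.
Proof.
case=> [m n A E a] [m' n' A' E' a'] /(can_inj CodeSeq.codeK) [/= mm nn].
case: m' / mm A' E'; case: n' / nn => A' E'.
move=> /(can_inj CodeSeq.codeK) /(inj_map (@mx_code_inj _ _)) ->.
by move=> /(can_inj CodeSeq.codeK) /(inj_map (@mx_code_inj _ _)) -> /rat_code_inj ->.
Qed.

(* Main.v *)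
Require Import Defs.
From mathcomp Require Import all_boot all_order all_algebra.
From mathcomp Require Import all_classical all_reals all_analysis.
From mathcomp Require Import ring zify.

Set Implicit Arguments.
Unset Strict Implicit.
Unset Printing Implicit Defensive.

Import Order.TTheory GRing.Theory Num.Theory.
Import numFieldNormedType.Exports.

Local Open Scope classical_set_scope.
Local Open Scope ring_scope.

(**
The reduction is a diagonal argument that needs no universal machine. Given a
register program [P] that decides the problem, let [T] be the program which
computes from its input [c] the code of a game [game T c], runs [P] on it,
halts if the answer is "yes" and loops if the answer is "no". The game is such
that [V <= 1] iff [T] does not halt on [c], so that [P] errs on it. The matrices
of [game T c] depend on [c] in two entries only, [2 ^ c] and [2 ^ - c]; hence
the code of the game is an iterated exponential in [c] whose nine coefficients
depend on [T] alone, and [T] is made independent of them by choosing for [c] a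
number that encodes them.

In the game, Adam simulates [T]. A row vector with a coordinate for each control
state and coordinates [2 ^ n], [2 ^ - n] for each register of content [n] is
updated by Adam's matrices, which also fill one more column: its value is at most
1 if Adam is honest and at least 2 if he departs from the run of [T] or gives up.
Eve either drops this column, or challenges Adam, which restarts the run with
the vector multiplied by the content of the column. If [T] halts after [K]
steps, Adam cannot avoid a factor 2 every [K + 1] rounds, and the value is
[2 ^ (1 / (K + 1))]. Otherwise Adam can be honest for [l] rounds and then give
up, for every [l], and the value is 1. These restarts keep the vector bounded
on the whole play, although the registers need not be bounded along a run.
*)

(** * Limits superior of roots *)

Lemma le_limn_esup (R : realType) (u v : (\bar R)^nat) :
  (forall n, u n <= v n)%E -> (limn_esup u <= limn_esup v)%E.
Proof.
move=> uv; rewrite !limn_esup_lim.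
apply: lee_lim; [exact: is_cvg_esups|exact: is_cvg_esups|].
apply: nearW => n; apply: ge_ereal_sup => _ [k /= nk <-].
by apply: (le_trans (uv k)); apply: ereal_sup_ubound; exists k.
Qed.

(** The constant contributes [C ^ (1 / (k + 1))], that is [expR (ln C / (k + 1))], which tends to 1:
    norms matter only up to a constant factor. *)
Lemma cvg_root_geometric (R : realType) (C r : R) : 0 < C -> 0 < r ->
  (fun k : nat => ((C * r ^+ k.+1) `^ (k.+1%:R)^-1)%:E) @ \oo --> r%:E.
Proof.
move=> C0 r0; apply: cvg_EFin; first exact: nearW.
have -> : fine \o (fun k : nat => ((C * r ^+ k.+1) `^ (k.+1%:R)^-1)%:E)
          = (fun k : nat => expR ((k.+1%:R)^-1 * ln C) * r).
  apply/funext => k /=.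
  rewrite powRM ?(ltW C0) ?exprn_ge0 ?(ltW r0)// -powR_mulrn ?(ltW r0)//.
  rewrite -powRrM mulfV ?pnatr_eq0// powRr1 ?(ltW r0)//.
  by rewrite /powR gt_eqF.
rewrite -[X in _ --> X]mul1r; apply: cvgMr_tmp.
rewrite -[X in _ --> X]expR0; apply: continuous_cvg; first exact: continuous_expR.
rewrite -[X in _ --> X](mul0r (ln C)); apply: cvgMr_tmp.
exact: (@cvg_harmonic R).
Qed.

Lemma limn_esup_root_le (R : realType) (u : nat -> R) (C r : R) :
  0 < C -> 0 < r -> (forall k, 0 <= u k <= C * r ^+ k.+1) ->
  (limn_esup (fun k : nat => (u k `^ (k.+1%:R)^-1)%:E) <= r%:E)%E.
Proof.
move=> C0 r0 ub.
have [_ <-] := cvg_limn_einf_sup (cvg_root_geometric C0 r0).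
apply: le_limn_esup => k; have /andP[u0 uC] := ub k.
by rewrite lee_fin ge0_ler_powR ?nnegrE ?mulr_ge0 ?exprn_ge0 ?(ltW C0) ?(ltW r0).
Qed.

Lemma limn_esup_root_ge (R : realType) (u : nat -> R) (C r : R) :
  0 < C -> 0 < r -> (forall k, C * r ^+ k.+1 <= u k) ->
  (r%:E <= limn_esup (fun k : nat => (u k `^ (k.+1%:R)^-1)%:E))%E.
Proof.
move=> C0 r0 lb.
have [_ <-] := cvg_limn_einf_sup (cvg_root_geometric C0 r0).
have Cr k : 0 <= C * r ^+ k.+1 by rewrite mulr_ge0 ?exprn_ge0 ?(ltW C0) ?(ltW r0).
apply: le_limn_esup => k; rewrite lee_fin ge0_ler_powR ?nnegrE //.
exact: le_trans (Cr k) (lb k).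
Qed.

(** * Values of matrix multiplication games *)

Definition mxle (R : numDomainType) (m n : nat) (X Y : 'M[R]_(m, n)) : Prop :=
  forall i j, X i j <= Y i j.

Lemma mxle_trans (R : numDomainType) (m n : nat) (Y X Z : 'M[R]_(m, n)) :
  mxle X Y -> mxle Y Z -> mxle X Z.
Proof. by move=> XY YZ i j; apply: le_trans (YZ i j). Qed.

Lemma mxleZ (R : numDomainType) (m n : nat) (a : R) (X Y : 'M[R]_(m, n)) :
  0 <= a -> mxle X Y -> mxle (a *: X) (a *: Y).
Proof. by move=> a0 XY i j; rewrite !mxE ler_wpM2l. Qed.

Lemma mxle_mulr (R : numDomainType) (m n p : nat) (X Y : 'M[R]_(m, n))
    (Z : 'M[R]_(n, p)) : mxle 0 Z -> mxle X Y -> mxle (X *m Z) (Y *m Z).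
Proof.
move=> Z0 XY i j; rewrite !mxE; apply: ler_sum => k _.
by apply: ler_wpM2r; [have := Z0 k j; rewrite mxE|exact: XY].
Qed.

Lemma mulmx_ge0 (R : numDomainType) (m n p : nat) (X : 'M[R]_(m, n))
    (Z : 'M[R]_(n, p)) : mxle 0 X -> mxle 0 Z -> mxle 0 (X *m Z).
Proof. by move=> X0 Z0; have := mxle_mulr Z0 X0; rewrite mul0mx. Qed.

Definition mass (R : numDomainType) (m : nat) (v : 'rV[R]_m) : R := \sum_j v 0 j.

Lemma massZ (R : numDomainType) (m : nat) (a : R) (v : 'rV[R]_m) :
  mass (a *: v) = a * mass v.
Proof. by rewrite /mass mulr_sumr; apply: eq_bigr => j _; rewrite mxE. Qed.

Lemma le_mass (R : numDomainType) (m : nat) (u v : 'rV[R]_m) :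
  mxle u v -> mass u <= mass v.
Proof. by move=> uv; apply: ler_sum => j _. Qed.

Lemma mass_ge0 (R : numDomainType) (m : nat) (v : 'rV[R]_m) :
  mxle 0 v -> 0 <= mass v.
Proof. by move=> v0; apply: sumr_ge0 => j _; have := v0 0 j; rewrite mxE. Qed.

(** The all-one row turns the norm of a product into the mass of a row vector, on which the rounds
    act one after the other. *)
Lemma norm1_mass (R : realType) (m n : nat) (X : 'M[R]_(m, n)) :
  mxle 0 X -> norm1 X = mass (const_mx 1 *m X).
Proof.
move=> X0; rewrite /norm1 /mass exchange_big /=; apply: eq_bigr => j _.
rewrite mxE; apply: eq_bigr => i _.
by rewrite mxE mul1r ger0_norm//; have := X0 i j; rewrite mxE.
Qed.

Lemma history_prod_rcons (R : realType) (M N : nat) (A : set 'M[R]_(M, N))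
    (E : set 'M[R]_(N, M)) (h : history A E) (r : A * E) :
  history_prod (rcons h r) = history_prod h *m (set_val r.1 *m set_val r.2).
Proof. by rewrite /history_prod -cats1 big_cat big_seq1. Qed.

Lemma history_prod_ge0 (R : realType) (M N : nat) (A : set 'M[R]_(M, N))
    (E : set 'M[R]_(N, M)) (h : history A E) :
  (forall X, A X -> mxle 0 X) -> (forall X, E X -> mxle 0 X) ->
  mxle 0 (history_prod h).
Proof.
move=> A0 E0; elim/last_ind: h => [|h r IH].
  by rewrite /history_prod big_nil => i j; rewrite !mxE ler0n.
rewrite history_prod_rcons; apply: mulmx_ge0 => //.
by apply: mulmx_ge0; [apply: A0|apply: E0]; exact: set_valP.
Qed.

Lemma lower_value_le_upper_value (R : realType) (M N : nat)
    (A : set 'M[R]_(M, N)) (E : set 'M[R]_(N, M)) :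
  (lower_value A E <= upper_value A E)%E.
Proof.
apply: ge_ereal_sup => _ [tau _ <-]; apply: le_ereal_inf_tmp => _ [sigma _ <-].
apply: (@le_trans _ _ (payoff sigma tau)).
  by apply: ereal_inf_lbound; exists sigma.
by apply: ereal_sup_ubound; exists tau.
Qed.

(* Adam follows the intended run [g 0, g 1, ...] for [l] rounds and then
   restarts, paying a factor 2 every [l.+1] rounds; a challenge by Eve brings
   the state back to [g 0] without gain.  The potential is [r ^+ (k - j)] with
   [k] the number of rounds and [j] the position in the run. *)
Lemma upper_value_le (R : realType) (M N : nat) (A : set 'M[R]_(M, N))
    (E : set 'M[R]_(N, M)) (g : nat -> 'rV[R]_M) (l : nat) (r C : R) :
  (forall X, A X -> mxle 0 X) -> (forall X, E X -> mxle 0 X) ->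
  (forall j, mxle 0 (g j)) -> 1 <= r -> r ^+ l.+1 = 2 -> 0 <= C ->
  (forall j, (j < l)%N -> exists2 X, A X & forall Y, E Y ->
    mxle (g j *m (X *m Y)) (g j.+1) \/ mxle (g j *m (X *m Y)) (g 0%N)) ->
  (exists2 X, A X & forall Y, E Y ->
    mxle (const_mx 1 *m (X *m Y)) (C *: g 0%N) /\
    mxle (g l *m (X *m Y)) (2 *: g 0%N)) ->
  (upper_value A E <= r%:E)%E.
Proof.
move=> A0 E0 g0 r1 rl C0 legal [Xr AXr restart].
have r0 : 0 < r := lt_le_trans ltr01 r1.
have /choice[mv mvP] : forall j, exists a : A, (j < l)%N -> forall Y, E Y ->
    mxle (g j *m (set_val a *m Y)) (g j.+1) \/
    mxle (g j *m (set_val a *m Y)) (g 0%N).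
  move=> j; have [jl|] := ltnP j l; last by exists (SigSub (mem_set AXr)).
  by have [X AX XP] := legal j jl; exists (SigSub (mem_set AX)).
(* The position in the run is recomputed from the history; it falls back to 0 after a challenge as
   well as after a restart. *)
pose next (j : nat) (ae : A * E) : nat := if (j < l)%N &&
  `[< mxle (g j *m (set_val ae.1 *m set_val ae.2)) (g j.+1) >] then j.+1 else 0%N.
(* Starting at position [l] makes Adam open with a restart, which brings the all-one row below
   [C *: g 0]. *)
pose st (h : history A E) := foldl next l h.
have st_le h : (st h <= l)%N.
  elim/last_ind: h => [|h ae _]; rewrite /st // foldl_rcons -/(st h) {1}/next.
  by case: ifP => // /andP[].
pose sigma : adam_strategy A E := fun h =>
  if (st h < l)%N then mv (st h) else SigSub (mem_set AXr).
apply: (@le_trans _ _ (ereal_sup [set payoff sigma tau | tau in setT])).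
  by apply: ereal_inf_lbound; exists sigma.
apply: ge_ereal_sup => _ [tau _ <-].
pose one : 'rV[R]_M := const_mx 1.
pose h k := play sigma tau k.
have inv k : mxle (one *m history_prod (h k.+1))
    ((C * r ^+ k.+1 / r ^+ st (h k.+1)) *: g (st (h k.+1))).
  elim: k => [|k].
    have st1 : st (h 1%N) = 0%N by rewrite /st /= /next ltnn.
    rewrite st1 expr0 divr1 /history_prod /= big_seq1 /sigma /st /= ltnn /=.
    have [H _] := restart _ (set_valP (tau [::] (SigSub (mem_set AXr)))).
    apply: (mxle_trans H) => i j; rewrite !mxE ler_wpM2r//.
      by have := g0 0%N i j; rewrite mxE.
    by rewrite ler_peMr.
  set hk := h k.+1; move=> IH; set j := st hk in IH.
  have -> : h k.+2 = rcons hk (sigma hk, tau hk (sigma hk)) by [].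
  set a := sigma hk; set e := tau hk a.
  have stE : st (rcons hk (a, e)) = next j (a, e) by rewrite /st foldl_rcons.
  rewrite history_prod_rcons stE mulmxA.
  have Z0 : mxle 0 (set_val a *m set_val e).
    by apply: mulmx_ge0; [apply: A0|apply: E0]; exact: set_valP.
  apply: (mxle_trans (mxle_mulr Z0 IH)); rewrite -scalemxAl.
  have Cr n m : 0 <= C * r ^+ n / r ^+ m.
    by rewrite divr_ge0 ?mulr_ge0 ?exprn_ge0 ?(ltW r0).
  have le_jl : (j <= l)%N by exact: st_le.
  rewrite /next /=; have [jl|lj] /= := ltnP j l.
    have mvj := mvP j jl (set_val e) (set_valP e).
    have aE : a = mv j by rewrite /a /sigma -/j jl.
    case: asboolP => [H|nH].
      apply: (mxle_trans (mxleZ (Cr _ _) H)) => i s.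
      rewrite !mxE [r ^+ k.+2]exprS [r ^+ j.+1]exprS.
      suff -> : C * (r * r ^+ k.+1) / (r * r ^+ j) = C * r ^+ k.+1 / r ^+ j by [].
      by rewrite mulrCA -mulf_div mulfV ?gt_eqF// mul1r.
    have H : mxle (g j *m (set_val a *m set_val e)) (g 0%N).
      by move: mvj nH; rewrite aE => -[].
    apply: (mxle_trans (mxleZ (Cr _ _) H)) => i s.
    rewrite !mxE ler_wpM2r//; first by have := g0 0%N i s; rewrite mxE.
    rewrite expr0 divr1 -mulrA ler_wpM2l// ler_pdivrMr ?exprn_gt0//.
    rewrite -[X in X <= _]mulr1 ler_pM ?exprn_ge0 ?ler01 ?(ltW r0)//.
      by rewrite ler_weXn2l.
    by rewrite exprn_ege1.
  have jE : j = l by apply/eqP; rewrite eqn_leq le_jl lj.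
  have aE : a = SigSub (mem_set AXr) by rewrite /a /sigma -/j jE ltnn.
  have [_ H] := restart _ (set_valP e).
  rewrite aE jE; apply: (mxle_trans (mxleZ (Cr _ _) H)) => i s.
  rewrite !mxE mulrA ler_wpM2r//; first by have := g0 0%N i s; rewrite mxE.
  (* The factor 2 of a restart equals [r ^+ l.+1], exactly what the potential gains when the
     position drops from [l] to 0 in one round. *)
  rewrite -rl expr0 divr1 [r ^+ l.+1]exprS mulrCA mulfVK ?expf_neq0 ?gt_eqF//.
  by rewrite mulrCA -exprS.
(* One constant serves all [l.+1] positions; adding 1 makes it positive. *)
pose D := C * (\sum_(j < l.+1) mass (g j)) + 1.
have S0 : 0 <= \sum_(j < l.+1) mass (g j).
  by apply: sumr_ge0 => j _; exact: mass_ge0.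
have D0 : 0 < D by rewrite ltr_wpDl // mulr_ge0.
apply: (limn_esup_root_le D0 r0) => k.
have P0 := @history_prod_ge0 _ _ _ _ _ (h k.+1) A0 E0.
rewrite norm1_mass //; apply/andP; split.
  by apply: mass_ge0; apply: mulmx_ge0 => // i j; rewrite !mxE.
apply: (le_trans (le_mass (inv k))); rewrite massZ.
set j := st _; have jl : (j < l.+1)%N by rewrite ltnS; exact: st_le.
have gj : mass (g j) <= \sum_(j < l.+1) mass (g j).
  rewrite (bigD1 (Ordinal jl)) //= lerDl.
  by apply: sumr_ge0 => i _; exact: mass_ge0.
rewrite /D mulrDl mul1r; apply: (@le_trans _ _ (C * (\sum_(j < l.+1) mass (g j)) * r ^+ k.+1)); last first.
  by rewrite lerDl exprn_ge0 ?(ltW r0).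
rewrite [X in _ <= X]mulrAC -[X in X <= _]mulrA ler_wpM2l ?mulr_ge0 ?exprn_ge0 ?(ltW r0)//.
apply: (le_trans _ gj); rewrite ler_piMl ?mass_ge0//.
by rewrite invf_le1 ?exprn_gt0// exprn_ege1.
Qed.

(* Eve lets the run [g 0, g 1, ...] proceed as long as Adam follows it, and
   challenges him, gaining a factor 2, as soon as he departs from it. *)
Lemma lower_value_ge (R : realType) (M N : nat) (A : set 'M[R]_(M, N))
    (E : set 'M[R]_(N, M)) (g : nat -> 'rV[R]_M) (P : nat -> Prop) (r : R) :
  A !=set0 ->
  (forall X, A X -> mxle 0 X) -> (forall X, E X -> mxle 0 X) ->
  (forall j, mxle 0 (g j)) -> (forall j, 1 <= mass (g j)) ->
  1 <= r ->
  P 0%N -> (forall j, P j -> r ^+ j.+1 <= 2) ->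
  (forall j X, P j -> A X -> exists2 Y, E Y &
    (P j.+1 /\ mxle (g j.+1) (g j *m (X *m Y))) \/
    mxle (2 *: g 0%N) (g j *m (X *m Y))) ->
  (r%:E <= lower_value A E)%E.
Proof.
move=> [X0 AX0] A0 E0 g0 g1 r1 P0 rP resp.
have r0 : 0 < r := lt_le_trans ltr01 r1.
(* Each coordinate of [g 0] is at most its mass, so [C *: g 0] lies below the all-one row. *)
pose C := (mass (g 0%N))^-1.
have m0 : 0 < mass (g 0%N) := lt_le_trans ltr01 (g1 0%N).
have C0 : 0 < C by rewrite invr_gt0.
have gC : mxle (C *: g 0%N) (const_mx 1).
  move=> i j; rewrite !mxE ord1 /C mulrC ler_pdivrMr // mul1r.
  rewrite /mass (bigD1 j) //= lerDl; apply: sumr_ge0 => k _.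
  by have := g0 0%N 0 k; rewrite mxE.
have /choice[ch chP] : forall ja : nat * A, exists e : E, P ja.1 ->
    (P ja.1.+1 /\ mxle (g ja.1.+1) (g ja.1 *m (set_val ja.2 *m set_val e))) \/
    mxle (2 *: g 0%N) (g ja.1 *m (set_val ja.2 *m set_val e)).
  move=> [j a]; have [Pj|nPj] := pselect (P j).
    have [Y EY YP] := resp j _ Pj (set_valP a).
    by exists (SigSub (mem_set EY)).
  have [Y EY _] := resp 0%N _ P0 AX0.
  by exists (SigSub (mem_set EY)).
pose next (j : nat) (ae : A * E) : nat := if
  `[< P j.+1 /\ mxle (g j.+1) (g j *m (set_val ae.1 *m set_val ae.2)) >]
  then j.+1 else 0%N.
pose st (h : history A E) := foldl next 0%N h.
pose tau : eve_strategy A E := fun h a => ch (st h, a).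
apply: (@le_trans _ _ (ereal_inf [set payoff sigma tau | sigma in setT])); last first.
  by apply: ereal_sup_ubound; exists tau.
apply: le_ereal_inf_tmp => _ [sigma _ <-].
pose h k := play sigma tau k.
have inv k : P (st (h k)) /\
    mxle ((r ^+ k / r ^+ st (h k)) *: g (st (h k))) (g 0%N *m history_prod (h k)).
  elim: k => [|k].
    rewrite /h /= /history_prod big_nil mulmx1 /st /= !expr0 divr1.
    by split => // i s; rewrite scale1r.
  set hk := h k; move=> [Pj IH]; set j := st hk in Pj IH.
  have -> : h k.+1 = rcons hk (sigma hk, tau hk (sigma hk)) by [].
  set a := sigma hk; set e := tau hk a.
  have stE : st (rcons hk (a, e)) = next j (a, e) by rewrite /st foldl_rcons.
  rewrite history_prod_rcons stE mulmxA.
  have Z0 : mxle 0 (set_val a *m set_val e).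
    by apply: mulmx_ge0; [apply: A0|apply: E0]; exact: set_valP.
  have {}IH := mxle_mulr Z0 IH; rewrite -scalemxAl in IH.
  have Cr n m : 0 <= r ^+ n / r ^+ m.
    by rewrite divr_ge0 ?exprn_ge0 ?(ltW r0).
  have chj := chP (j, a) Pj.
  rewrite /next /=; case: asboolP => [[Pj1 H]|nH]; split=> //;
    apply: mxle_trans IH.
    rewrite [r ^+ k.+1]exprS [r ^+ j.+1]exprS -mulf_div mulfV ?gt_eqF// mul1r.
    exact: mxleZ.
  have H : mxle (2 *: g 0%N) (g j *m (set_val a *m set_val e)) by case: chj.
  apply: mxle_trans (mxleZ (Cr _ _) H) => i s.
  rewrite !mxE mulrA ler_wpM2r//; first by have := g0 0%N i s; rewrite mxE.
  (* The gain 2 of a challenge makes up for [r ^+ j.+1], by [rP]. *)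
  rewrite expr0 divr1 exprSr -mulrA ler_wpM2l ?exprn_ge0 ?(ltW r0)//.
  rewrite mulrC ler_pdivlMr ?exprn_gt0// -exprS.
  exact: rP.
(* The factor [1 / 2] pays for the unfinished run, since [r ^+ j <= r ^+ j.+1 <= 2]. *)
have D0 : 0 < C / 2 by rewrite divr_gt0.
apply: (limn_esup_root_ge D0 r0) => k.
have H0 := @history_prod_ge0 _ _ _ _ _ (h k.+1) A0 E0.
rewrite norm1_mass //; have [Pj ik] := inv k.+1; set j := st _ in Pj ik.
apply: le_trans (le_mass (mxle_mulr H0 gC)).
rewrite -scalemxAl massZ -mulrA ler_wpM2l ?(ltW C0)//.
apply: le_trans (le_mass ik); rewrite massZ.
apply: (@le_trans _ _ (r ^+ k.+1 / r ^+ j)); last first.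
  by rewrite ler_peMr ?divr_ge0 ?exprn_ge0 ?(ltW r0).
rewrite mulrC ler_wpM2l ?exprn_ge0 ?(ltW r0)//.
rewrite lef_pV2 ?posrE ?exprn_gt0//; apply: le_trans (rP j Pj).
by rewrite ler_weXn2l.
Qed.

(** * Register programs *)

Section Programs.
Local Open Scope nat_scope.

(** * Runs, structured commands and their compilation *)

Definition runs (Q : program) (c c' : config) : Prop :=
  exists k, iter k (step Q) c = c'.

Lemma runs_refl (Q : program) (c : config) : runs Q c c.
Proof. by exists 0. Qed.

Lemma runs_trans (Q : program) (c1 c2 c3 : config) :
  runs Q c1 c2 -> runs Q c2 c3 -> runs Q c1 c3.
Proof. by move=> [k <-] [k' <-]; exists (k' + k); rewrite iterD. Qed.

Lemma runs_step (Q : program) (c c' : config) :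
  runs Q (step Q c) c' -> runs Q c c'.
Proof. by move=> [k <-]; exists k.+1; rewrite iterSr. Qed.

Lemma onth_cat_size (T : Type) (s1 s2 : seq T) (i : nat) :
  onth (s1 ++ s2) (size s1 + i) = onth s2 i.
Proof. by elim: s1. Qed.

Lemma onth_cat_cons (T : Type) (s1 s2 : seq T) (x : T) :
  onth (s1 ++ x :: s2) (size s1) = Some x.
Proof. by elim: s1. Qed.

Lemma set_regK (f : nat -> nat) (r : nat) : set_reg f r (f r) = f.
Proof. by apply/funext => s; rewrite /set_reg; case: eqP => // ->. Qed.

Lemma set_reg_set (f : nat -> nat) (r v w : nat) :
  set_reg (set_reg f r v) r w = set_reg f r w.
Proof. by apply/funext => s; rewrite /set_reg; case: eqP. Qed.

Lemma set_reg_eq (f : nat -> nat) (r v : nat) : set_reg f r v r = v.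
Proof. by rewrite /set_reg eqxx. Qed.

Lemma set_reg_neq (f : nat -> nat) (r s v : nat) :
  s != r -> set_reg f r v s = f s.
Proof. by rewrite /set_reg => /negbTE ->. Qed.

Lemma set_reg_nth (s : seq nat) (r v : nat) :
  set_reg (nth 0 s) r v = nth 0 (set_nth 0 s r v).
Proof. by apply/funext => t; rewrite nth_set_nth. Qed.

(* [Loop r c] repeats "decrement [r]; [c]" until [r] is zero; [Cond r a b] runs
   [a] when [r] is zero and otherwise decrements [r] and runs [b]. *)
Inductive cmd : Type :=
| Incr of nat
| Then of cmd & cmd
| Loop of nat & cmd
| Cond of nat & cmd & cmd.

Fixpoint den (c : cmd) (f : nat -> nat) : nat -> nat :=
  match c with
  | Incr r => set_reg f r (f r).+1
  | Then a b => den b (den a f)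
  | Loop r a => iter (f r) (fun g => den a (set_reg g r (g r).-1)) f
  | Cond r a b => if f r == 0 then den a f else den b (set_reg f r (f r).-1)
  end.

Fixpoint writes (c : cmd) : seq nat :=
  match c with
  | Incr r => [:: r]
  | Then a b => writes a ++ writes b
  | Loop r a => r :: writes a
  | Cond r a b => r :: writes a ++ writes b
  end.

(** [den] fixes the number of passes of a [Loop] on entry, whereas the compiled code tests the
    counter before each pass; the two agree when the body does not write the counter. *)
Fixpoint bounded_loops (c : cmd) : bool :=
  match c with
  | Incr r => true
  | Then a b => bounded_loops a && bounded_loops b
  | Loop r a => (r \notin writes a) && bounded_loops a
  | Cond r a b => bounded_loops a && bounded_loops b
  end.

Fixpoint csize (c : cmd) : nat :=
  match c with
  | Incr r => 1
  | Then a b => csize a + csize b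
  | Loop r a => (csize a).+2
  | Cond r a b => (csize b + csize a).+2
  end.

(* Register [z] is kept at zero, which makes [Dec z j] an unconditional jump. *)
Fixpoint comp (z : nat) (c : cmd) (o : nat) : program :=
  match c with
  | Incr r => [:: Inc r]
  | Then a b => comp z a o ++ comp z b (o + csize a)
  | Loop r a => Dec r (o + (csize a).+2) :: comp z a o.+1 ++ [:: Dec z o]
  | Cond r a b =>
      Dec r (o + (csize b).+2) :: comp z b o.+1 ++
      Dec z (o + (csize b + csize a).+2) :: comp z a (o + (csize b).+2)
  end.

Lemma size_comp (z : nat) (c : cmd) (o : nat) : size (comp z c o) = csize c.
Proof.
elim: c o => [r|a IHa b IHb|r a IHa|r a IHa b IHb] o //=.
- by rewrite size_cat IHa IHb.
- by rewrite size_cat IHa addn1.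
- by rewrite size_cat /= IHa IHb addnS.
Qed.

Lemma den_unwritten (c : cmd) (f : nat -> nat) (r : nat) :
  r \notin writes c -> den c f r = f r.
Proof.
elim: c f => [s|a IHa b IHb|s a IHa|s a IHa b IHb] f /=.
- by rewrite inE => rs; rewrite set_reg_neq.
- by rewrite mem_cat negb_or => /andP[ra rb]; rewrite IHb // IHa.
- rewrite inE negb_or => /andP[rs ra].
  by elim: (f s) => //= n IH; rewrite IHa // set_reg_neq.
- rewrite inE mem_cat !negb_or => /and3P[rs ra rb].
  by case: ifP => _; [rewrite IHa|rewrite IHb // set_reg_neq].
Qed.

(** Jump targets are absolute, so the code is studied between arbitrary [pre] and [post]; for a
    subcommand, the surrounding code is absorbed into these two. *)
Lemma comp_runs (z : nat) (c : cmd) (pre post : program) (f : nat -> nat) :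
  z \notin writes c -> bounded_loops c -> f z = 0 ->
  runs (pre ++ comp z c (size pre) ++ post)
    (size pre, f) (size pre + csize c, den c f).
Proof.
elim: c pre post f => [r|a IHa b IHb|r a IHa|r a IHa b IHb] pre post f /=.
- move=> _ _ fz; apply: runs_step.
  by rewrite /step onth_cat_cons addn1; exact: runs_refl.
- rewrite mem_cat negb_or => /andP[za zb] /andP[ba bb] fz.
  apply: (@runs_trans _ _ (size pre + csize a, den a f)).
    by rewrite -catA; exact: IHa.
  have := IHb (pre ++ comp z a (size pre)) post (den a f) zb bb.
  rewrite size_cat size_comp -!catA addnA; apply.
  by rewrite den_unwritten.
- rewrite inE negb_or => /andP[zr za] /andP[ra ba] fz.
  set o := size pre; set Q := pre ++ _.
  have Q0 : onth Q o = Some (Dec r (o + (csize a).+2)).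
    by rewrite /Q onth_cat_cons.
  have Q1 : onth Q (o.+1 + csize a) = Some (Dec z o).
    rewrite addSnnS /Q onth_cat_size /= -catA.
    by rewrite -(size_comp z a o.+1) onth_cat_cons.
  (* Inner induction on the value of the counter at the loop test. *)
  move: {2 3}(f r) (erefl (f r)) => n.
  elim: n f fz => [|n IH] f fz fr.
    by apply: runs_step; rewrite /= Q0 fr /=; exact: runs_refl.
  apply: runs_step; rewrite /step Q0 fr; rewrite iterSr fr /=.
  have -> : set_reg f r n = set_reg f r (f r).-1 by rewrite fr.
  set f' := set_reg f r _.
  have f'z : f' z = 0 by rewrite /f' set_reg_neq.
  apply: (@runs_trans _ _ (o.+1 + csize a, den a f')).
    have := IHa (rcons pre (Dec r (o + (csize a).+2))) (Dec z o :: post) f' za ba f'z.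
    by rewrite size_rcons -/o /= cat_rcons /Q /= -catA.
  apply: runs_step; rewrite /step Q1 den_unwritten // f'z eqxx.
  apply: IH; first by rewrite den_unwritten.
  by rewrite den_unwritten // /f' set_reg_eq fr.
- rewrite inE mem_cat !negb_or => /and3P[zr za zb] /andP[ba bb] fz.
  set o := size pre; set Q := pre ++ _.
  have Q0 : onth Q o = Some (Dec r (o + (csize b).+2)).
    by rewrite /Q onth_cat_cons.
  have Q1 : onth Q (o.+1 + csize b) = Some (Dec z (o + (csize b + csize a).+2)).
    rewrite addSnnS /Q onth_cat_size /= -catA.
    by rewrite -[X in onth _ X = _](size_comp z b o.+1) onth_cat_cons.
  have [f0|f0] := eqVneq (f r) 0.
    apply: runs_step; rewrite /step Q0 f0 eqxx.
    set pre' := pre ++ Dec r (o + (csize b).+2) :: comp z b o.+1 ++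
      [:: Dec z (o + (csize b + csize a).+2)].
    have spre' : size pre' = o + (csize b).+2.
      by rewrite /pre' size_cat /= size_cat /= size_comp addn1.
    have -> : Q = pre' ++ comp z a (size pre') ++ post.
      by rewrite spre' /Q /pre' /= -!catA /= -!catA.
    have -> : o + (csize b + csize a).+2 = size pre' + csize a.
      by rewrite spre' -addnA !addSn.
    by rewrite -spre'; exact: IHa.
  apply: runs_step; rewrite /step Q0 (negbTE f0).
  set f' := set_reg f r _.
  have f'z : f' z = 0 by rewrite /f' set_reg_neq.
  apply: (@runs_trans _ _ (o.+1 + csize b, den b f')).
    have := IHb (rcons pre (Dec r (o + (csize b).+2)))
      (Dec z (o + (csize b + csize a).+2) :: comp z a (o + (csize b).+2) ++ post)
      f' zb bb f'z.
    by rewrite size_rcons -/o /= cat_rcons /Q /= -catA.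
  apply: runs_step; rewrite /step Q1 den_unwritten // f'z eqxx.
  exact: runs_refl.
Qed.

(** * Embedding a program into a larger one *)

(* Jumps out of [P] are redirected to the address right after it. *)
Definition relocate (P : program) (o d : nat) : program :=
  [seq match i with
       | Inc r => Inc (d + r)
       | Dec r j => Dec (d + r) (o + minn j (size P))
       end | i <- P].

Lemma onth_map (T U : Type) (F : T -> U) (s : seq T) (i : nat) :
  onth (map F s) i = omap F (onth s i).
Proof. by elim: s i => [|x s IH] [|i] //=. Qed.

Lemma onth_cat_lt (T : Type) (s1 s2 : seq T) (i : nat) :
  i < size s1 -> onth (s1 ++ s2) i = onth s1 i.
Proof. by elim: s1 i => [|x s IH] [|i] //= /IH. Qed.

Lemma onth_ge (T : Type) (s : seq T) (i : nat) : size s <= i -> onth s i = None.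
Proof. by elim: s i => [|x s IH] [|i] //= /IH. Qed.

Lemma onth_lt (T : Type) (s : seq T) (i : nat) :
  i < size s -> exists x, onth s i = Some x.
Proof. by elim: s i => [|x s IH] [|i] //=; [exists x|move=> /IH]. Qed.

Lemma step_relocate (P pre post : program) (d pc : nat) (g : nat -> nat) :
  let o := size pre in let Q := pre ++ relocate P o d ++ post in
  exists g', runs Q (o + minn pc (size P), g)
                    (o + minn (step P (pc, fun r => g (d + r))).1 (size P), g')
    /\ (fun r => g' (d + r)) = (step P (pc, fun r => g (d + r))).2.
Proof.
move=> o Q; have [pcP|Ppc] := ltnP pc (size P); last first.
  rewrite /= onth_ge //=; exists g; split => //.
  by rewrite (minn_idPr Ppc); exact: runs_refl.
have [i iE] := onth_lt pcP.
have QE : onth Q (o + pc) = onth (relocate P o d) pc.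
  by rewrite /Q onth_cat_size onth_cat_lt // size_map.
rewrite /= iE.
rewrite /relocate onth_map iE /= in QE.
case: i {iE} QE => [r|r j] QE /=.
  exists (set_reg g (d + r) (g (d + r)).+1); split.
    apply: runs_step; rewrite /step QE (minn_idPl pcP) addnS.
    exact: runs_refl.
  by apply/funext => s; rewrite /set_reg eqn_add2l.
case: ifP => gr /=.
  exists g; split => //; apply: runs_step; rewrite /step QE gr.
  exact: runs_refl.
exists (set_reg g (d + r) (g (d + r)).-1); split.
  apply: runs_step; rewrite /step QE gr (minn_idPl pcP) addnS.
  exact: runs_refl.
by apply/funext => s; rewrite /set_reg eqn_add2l.
Qed.

Lemma runs_relocate (P pre post : program) (d k : nat) (g : nat -> nat) :
  let o := size pre in let Q := pre ++ relocate P o d ++ post in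
  exists g', runs Q (o, g)
      (o + minn (iter k (step P) (0, fun r => g (d + r))).1 (size P), g')
    /\ (fun r => g' (d + r)) = (iter k (step P) (0, fun r => g (d + r))).2.
Proof.
move=> o Q; elim: k => [|k [g' [Hg' g'E]]] /=.
  by exists g; split => //; rewrite min0n addn0; exact: runs_refl.
move: Hg' g'E; case: (iter k _ _) => [pc f] /= Hg' fE.
have [g'' [H1 H2]] := step_relocate P pre post d pc g'.
exists g''; rewrite fE in H1 H2; split => //.
exact: runs_trans Hg' H1.
Qed.

(** * Arithmetic commands *)

(* Register 1 is scratch space and must be zero. *)
Definition double (r : nat) : cmd :=
  Then (Loop r (Then (Incr 1) (Incr 1))) (Loop 1 (Incr r)).

Lemma den_move (r s : nat) (f : nat -> nat) : r != s ->
  den (Loop r (Incr s)) f = set_reg (set_reg f r 0) s (f s + f r).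
Proof.
move=> rs /=; have sr : s != r by rewrite eq_sym.
suff H n g : g r = n -> iter n (fun g => set_reg (set_reg g r (g r).-1) s
    (set_reg g r (g r).-1 s).+1) g = set_reg (set_reg g r 0) s (g s + n).
  exact: H.
elim: n g => [|n IH] g gr.
  by rewrite /= addn0 -gr set_regK set_regK.
rewrite iterSr IH; last by rewrite set_reg_neq // set_reg_eq gr.
apply/funext => t; rewrite /set_reg eqxx (negbTE sr) addSnnS.
by case: eqP => // _; case: eqP.
Qed.

Lemma den_double (r : nat) (f : nat -> nat) : r != 1 -> f 1 = 0 ->
  den (double r) f = set_reg f r (2 * f r).
Proof.
move=> r1 f1.
have E : den (Loop r (Then (Incr 1) (Incr 1))) f
    = set_reg (set_reg f r 0) 1 (f r).*2.
  rewrite /=; suff H n h : h r = n -> iter n (fun h => set_reg (set_reg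
      (set_reg h r (h r).-1) 1 (set_reg h r (h r).-1 1).+1) 1
      (set_reg (set_reg h r (h r).-1) 1 (set_reg h r (h r).-1 1).+1 1).+1) h
      = set_reg (set_reg h r 0) 1 (h 1 + n.*2).
    by rewrite H // f1.
  elim: n h => [|n IH] h hr.
    by rewrite /= double0 addn0 -[X in set_reg h r X]hr !set_regK.
  rewrite iterSr IH; last by rewrite /set_reg /= (negbTE r1) eqxx hr.
  apply/funext => t; rewrite /set_reg /= [1 == r]eq_sym (negbTE r1) doubleS.
  case: eqP => [_|_]; first lia.
  by case: eqP.
have -> : den (double r) f =
  den (Loop 1 (Incr r)) (den (Loop r (Then (Incr 1) (Incr 1))) f) by [].
rewrite E den_move; last by rewrite eq_sym.
apply/funext => t; rewrite /set_reg /= (negbTE r1) eqxx mul2n add0n.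
by case: eqP => // _; case: eqP => // ->.
Qed.

(** There is no empty command, so [n] stands for [n.+1] doublings; [doubles 9] and [doubles 17] thus
    produce the exponents [10 * d] and [18 * d] of [tower]. *)
Fixpoint doubles (n r : nat) : cmd :=
  if n is m.+1 then Then (double r) (doubles m r) else double r.

Lemma den_doubles (n r : nat) (f : nat -> nat) : r != 1 -> f 1 = 0 ->
  den (doubles n r) f = set_reg f r (f r * 2 ^ n.+1).
Proof.
move=> r1; elim: n f => [|n IH] f f1.
  by rewrite [doubles _ _]/= den_double // mulnC.
rewrite [doubles _ _]/= [den _ _]/= -/(double r) -/(den (double r) f).
have := den_double r1 f1; rewrite /double /= => ->.
rewrite IH; last by rewrite set_reg_neq // eq_sym.
by rewrite set_reg_eq set_reg_set [2 ^ n.+2]expnS mulnA (mulnC 2).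
Qed.

Lemma den_shift (n x r : nat) (f : nat -> nat) :
  r != 1 -> x != r -> x != 1 -> f 1 = 0 ->
  den (Loop x (doubles n r)) f =
  set_reg (set_reg f x 0) r (f r * 2 ^ (n.+1 * f x)).
Proof.
move=> r1 xr x1 f1; rewrite /=.
have rx : r != x by rewrite eq_sym.
suff H m g : g x = m -> g 1 = 0 ->
    iter m (fun g => den (doubles n r) (set_reg g x (g x).-1)) g
    = set_reg (set_reg g x 0) r (g r * 2 ^ (n.+1 * m)).
  exact: H.
elim: m g => [|m IH] g gx g1.
  by rewrite /= muln0 expn0 muln1 -[X in set_reg g x X]gx !set_regK.
have g1' v : set_reg g x v 1 = 0 by rewrite set_reg_neq // eq_sym.
rewrite iterSr IH den_doubles //.
- apply/funext => t; rewrite /set_reg eqxx (negbTE rx) -mulnA -expnD mulnS.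
  by case: eqP => // _; case: eqP.
- by rewrite /set_reg (negbTE xr) eqxx gx.
- by rewrite set_reg_neq // eq_sym.
Qed.

Lemma den_copy (x r s : nat) (f : nat -> nat) :
  x != r -> x != s -> r != s ->
  den (Loop x (Then (Incr r) (Incr s))) f =
  set_reg (set_reg (set_reg f x 0) r (f r + f x)) s (f s + f x).
Proof.
move=> xr xs rs; rewrite /=.
suff H n g : g x = n -> iter n (fun g => set_reg (set_reg (set_reg g x (g x).-1)
      r (set_reg g x (g x).-1 r).+1) s
      (set_reg (set_reg g x (g x).-1) r (set_reg g x (g x).-1 r).+1 s).+1) g
    = set_reg (set_reg (set_reg g x 0) r (g r + n)) s (g s + n).
  exact: H.
elim: n g => [|n IH] g gx.
  by rewrite /= !addn0 -[X in set_reg g x X]gx !set_regK.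
rewrite iterSr IH; last by rewrite /set_reg (negbTE xr) (negbTE xs) eqxx gx.
apply/funext => t; rewrite /set_reg !eqxx (negbTE rs) [r == x]eq_sym [s == x]eq_sym.
rewrite [s == r]eq_sym (negbTE rs) (negbTE xr) (negbTE xs) !addSnnS.
by case: eqP => // _; case: eqP => // _; case: eqP.
Qed.

(** * Unpairing and the computation of the code of the game *)

(* The successor function of Cantor's enumeration of [nat * nat]. *)
Definition pair_succ (p : nat * nat) : nat * nat :=
  if p.1 is i.+1 then (i, p.2.+1) else (p.2.+1, 0).

Definition unpair (n : nat) : nat * nat := iter n pair_succ (0, 0).

(** Induction on the antidiagonal [i + j], then on [j]: [(i, j.+1)] follows [(i.+1, j)], and
    [(m.+1, 0)] follows [(0, m)]. *)
Lemma unpair_surj (i j : nat) : exists n, unpair n = (i, j).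
Proof.
have [m mE] : exists m, m = i + j by exists (i + j).
elim: m i j mE => [|m IHm] i j.
  by case: i j => [|i] [|j] //; exists 0.
elim: j i => [|j IHj] i.
  rewrite addn0 => <-; have [//|n nE] := IHm 0 m.
  by exists n.+1; rewrite /unpair iterS -/(unpair n) nE.
move=> mE; have [|n nE] := IHj i.+1; first by rewrite mE addSnnS.
by exists n.+1; rewrite /unpair iterS -/(unpair n) nE.
Qed.

Definition unpair_step (i j : nat) : cmd :=
  Cond i (Then (Loop j (Incr i)) (Incr i)) (Incr j).

Lemma den_unpair_step (i j : nat) (f : nat -> nat) : i != j ->
  den (unpair_step i j) f =
  set_reg (set_reg f i (pair_succ (f i, f j)).1) j (pair_succ (f i, f j)).2.
Proof.
move=> ij; have ji : j != i by rewrite eq_sym.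
rewrite /pair_succ; case fi : (f i) => [|k].
  have -> : den (unpair_step i j) f = den (Incr i) (den (Loop j (Incr i)) f).
    by rewrite /= fi.
  rewrite den_move //= fi; apply/funext => t.
  by rewrite /set_reg eqxx; case: (t =P i) => [->|//]; rewrite (negbTE ij).
rewrite /= fi /=; apply/funext => t.
by rewrite /set_reg (negbTE ji).
Qed.

Lemma den_unpair (x i j : nat) (f : nat -> nat) :
  x != i -> x != j -> i != j -> f i = 0 -> f j = 0 ->
  den (Loop x (unpair_step i j)) f =
  set_reg (set_reg (set_reg f x 0) i (unpair (f x)).1) j (unpair (f x)).2.
Proof.
move=> xi xj ij fi fj.
have -> : unpair (f x) = iter (f x) pair_succ (f i, f j) by rewrite fi fj.
have -> : den (Loop x (unpair_step i j)) f =
  iter (f x) (fun g => den (unpair_step i j) (set_reg g x (g x).-1)) f by [].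
have [ix [jx ji]] : i != x /\ j != x /\ j != i by rewrite ![_ == x]eq_sym [j == i]eq_sym.
move: {2 3 4 5}(f x) (erefl (f x)) => n.
elim: n f {fi fj} => [|n IH] f fx.
  by rewrite /= -[X in set_reg f x X]fx !set_regK.
have fx' : den (unpair_step i j) (set_reg f x (f x).-1) x = n.
  by rewrite den_unpair_step // /set_reg (negbTE xi) (negbTE xj) eqxx fx.
rewrite iterSr IH // den_unpair_step // iterSr.
have -> : set_reg f x (f x).-1 i = f i by rewrite set_reg_neq.
have -> : set_reg f x (f x).-1 j = f j by rewrite set_reg_neq.
set q := pair_succ _.
have -> : (set_reg (set_reg (set_reg f x (f x).-1) i q.1) j q.2 i,
           set_reg (set_reg (set_reg f x (f x).-1) i q.1) j q.2 j) = q.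
  by rewrite /set_reg (negbTE ij) !eqxx; case: (q).
apply/funext => t; rewrite /set_reg.
by case: eqP => // _; case: eqP => // _; case: eqP.
Qed.

Definition unpack (c : nat) : seq nat :=
  let u0 := unpair c in let u1 := unpair u0.2 in let u2 := unpair u1.2 in
  let u3 := unpair u2.2 in let u4 := unpair u3.2 in let u5 := unpair u4.2 in
  let u6 := unpair u5.2 in let u7 := unpair u6.2 in
  [:: u0.1; u1.1; u2.1; u3.1; u4.1; u5.1; u6.1; u7.1; u7.2].

Lemma unpack_surj (a0 b0 e0 a1 b1 a2 b2 a3 b3 : nat) :
  exists c, unpack c = [:: a0; b0; e0; a1; b1; a2; b2; a3; b3].
Proof.
have [c7 E7] := unpair_surj a3 b3.
have [c6 E6] := unpair_surj b2 c7.
have [c5 E5] := unpair_surj a2 c6.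
have [c4 E4] := unpair_surj b1 c5.
have [c3 E3] := unpair_surj a1 c4.
have [c2 E2] := unpair_surj e0 c3.
have [c1 E1] := unpair_surj b0 c2.
have [c0 E0] := unpair_surj a0 c1.
by exists c0; rewrite /unpack E0 E1 E2 E3 E4 E5 E6 E7.
Qed.

(** The innermost sum is the code of the nonzero row of [challenge_mx]. Each further exponential is
    one level of nesting: the row in the matrix, the matrix in Eve's list, the list in the
    instance. *)
Definition tower (s : seq nat) (c : nat) : nat :=
  let d := 2 ^ 2 ^ c in
  let y := nth 0 s 0 + nth 0 s 1 * 2 ^ (10 * d) + nth 0 s 2 * 2 ^ (18 * d) in
  let y := nth 0 s 3 + nth 0 s 4 * 2 ^ y in
  let y := nth 0 s 5 + nth 0 s 6 * 2 ^ y in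
  nth 0 s 7 + nth 0 s 8 * 2 ^ y.

(* Registers 4, 6, 8, 10, 12, 14, 16, 18, 2 receive the nine numbers of
   [unpack c], and register 3 receives [2 ^ 2 ^ c]. *)
Definition prelude : seq cmd :=
  [:: Loop 0 (Then (Incr 2) (Incr 3));
      Incr 0; Loop 3 (doubles 0 0);
      Incr 3; Loop 0 (doubles 0 3);
      Loop 2 (unpair_step 4 5);
      Loop 5 (unpair_step 6 7);
      Loop 7 (unpair_step 8 9);
      Loop 9 (unpair_step 10 11);
      Loop 11 (unpair_step 12 13);
      Loop 13 (unpair_step 14 15);
      Loop 15 (unpair_step 16 17);
      Loop 17 (unpair_step 18 2);
      Loop 3 (Then (Incr 0) (Incr 5));
      Loop 0 (doubles 9 6); Loop 6 (Incr 4);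
      Loop 5 (doubles 17 8); Loop 8 (Incr 4);
      Loop 4 (doubles 0 12); Loop 12 (Incr 10);
      Loop 10 (doubles 0 16); Loop 16 (Incr 14);
      Loop 14 (doubles 0 2); Loop 2 (Incr 18)].

Definition prelude_cmd : cmd := foldr Then (Loop 18 (Incr 20)) prelude.

Lemma den_foldr (s : seq cmd) (a c : cmd) (f : nat -> nat) :
  den (foldr Then c (a :: s)) f = den (foldr Then c s) (den a f).
Proof. by []. Qed.

Lemma den_incr (r : nat) (f : nat -> nat) : den (Incr r) f = set_reg f r (f r).+1.
Proof. by []. Qed.

(** Symbolic execution: the registers are a finite list of values with default 0, and each command
    becomes an update of that list. *)
Lemma den_prelude (c : nat) :
  den prelude_cmd (init_config c).2 =
  set_reg (fun=> 0) 20 (tower (unpack c) c).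
Proof.
have -> : (init_config c).2 = nth 0 [:: c].
  by apply/funext => -[|[|r]].
case E0 : (unpair c) => [a0 c1].
case E1 : (unpair c1) => [b0 c2].
case E2 : (unpair c2) => [e0 c3].
case E3 : (unpair c3) => [a1 c4].
case E4 : (unpair c4) => [b1 c5].
case E5 : (unpair c5) => [a2 c6].
case E6 : (unpair c6) => [b2 c7].
case E7 : (unpair c7) => [a3 b3].
have -> : unpack c = [:: a0; b0; e0; a1; b1; a2; b2; a3; b3].
  by rewrite /unpack E0 E1 E2 E3 E4 E5 E6 E7.
rewrite /prelude_cmd /prelude.
rewrite den_foldr den_copy // !set_reg_nth [set_nth _ _ _ _]/=.
rewrite den_foldr den_incr !set_reg_nth [set_nth _ _ _ _]/=.
rewrite den_foldr den_shift // !set_reg_nth [set_nth _ _ _ _]/=.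
rewrite den_foldr den_incr !set_reg_nth [set_nth _ _ _ _]/=.
rewrite den_foldr den_shift // !set_reg_nth [set_nth _ _ _ _]/=.
rewrite den_foldr den_unpair // [nth _ _ _]/= add0n E0 !set_reg_nth [set_nth _ _ _ _]/=.
rewrite den_foldr den_unpair // [nth _ _ _]/= E1 !set_reg_nth [set_nth _ _ _ _]/=.
rewrite den_foldr den_unpair // [nth _ _ _]/= E2 !set_reg_nth [set_nth _ _ _ _]/=.
rewrite den_foldr den_unpair // [nth _ _ _]/= E3 !set_reg_nth [set_nth _ _ _ _]/=.
rewrite den_foldr den_unpair // [nth _ _ _]/= E4 !set_reg_nth [set_nth _ _ _ _]/=.
rewrite den_foldr den_unpair // [nth _ _ _]/= E5 !set_reg_nth [set_nth _ _ _ _]/=.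
rewrite den_foldr den_unpair // [nth _ _ _]/= E6 !set_reg_nth [set_nth _ _ _ _]/=.
rewrite den_foldr den_unpair // [nth _ _ _]/= E7 !set_reg_nth [set_nth _ _ _ _]/=.
rewrite den_foldr den_copy // !set_reg_nth [set_nth _ _ _ _]/=.
rewrite den_foldr den_shift // !set_reg_nth [set_nth _ _ _ _]/=.
rewrite den_foldr den_move // !set_reg_nth [set_nth _ _ _ _]/=.
rewrite den_foldr den_shift // !set_reg_nth [set_nth _ _ _ _]/=.
rewrite den_foldr den_move // !set_reg_nth [set_nth _ _ _ _]/=.
rewrite den_foldr den_shift // !set_reg_nth [set_nth _ _ _ _]/=.
rewrite den_foldr den_move // !set_reg_nth [set_nth _ _ _ _]/=.
rewrite den_foldr den_shift // !set_reg_nth [set_nth _ _ _ _]/=.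
rewrite den_foldr den_move // !set_reg_nth [set_nth _ _ _ _]/=.
rewrite den_foldr den_shift // !set_reg_nth [set_nth _ _ _ _]/=.
rewrite den_foldr den_move // !set_reg_nth [set_nth _ _ _ _]/=.
rewrite [foldr _ _ _]/= den_move // !add0n !mul1n.
(* Registers 0 to 20 are compared one by one; beyond them both sides are 0. *)
by apply/funext => r; do 21 (case: r => [|r] //).
Qed.

(** * The diagonal program *)

Lemma comp_runs0 (z : nat) (c : cmd) (post : program) (f : nat -> nat) :
  z \notin writes c -> bounded_loops c -> f z = 0 ->
  runs (comp z c 0 ++ post) (0, f) (size (comp z c 0), den c f).
Proof.
by move=> zc bc fz; rewrite size_comp; exact: (@comp_runs z c [::] post f).
Qed.

(* [Dec 20] jumps to itself forever if [P], whose register 0 is register 20,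
   answers 0, and falls through to the end of the program if [P] answers 1. *)
Definition switch (pre P : program) : program :=
  pre ++ relocate P (size pre) 20 ++ [:: Dec 20 (size pre + size P)].

(* [prelude_cmd] leaves registers 19 and above at zero, except for the result in
   register 20; register 19 is the zero register of the jumps. *)
Definition diagonal_program (P : program) : program :=
  switch (comp 19 prelude_cmd 0) P.

Lemma onth_switch (pre P : program) :
  onth (switch pre P) (size pre + size P) = Some (Dec 20 (size pre + size P)).
Proof.
rewrite /switch onth_cat_size.
have E : size (relocate P (size pre) 20) = size P by rewrite size_map.
by rewrite -[X in onth _ X]E onth_cat_cons.
Qed.

Lemma size_switch (pre P : program) :
  size (switch pre P) = (size pre + size P).+1.
Proof. by rewrite !size_cat size_map addnA addn1. Qed.

Lemma diagonal_runs (P : program) (c y : nat) :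
  computes P (tower (unpack c) c) y ->
  exists g, g 20 = y /\ runs (diagonal_program P) (init_config c)
    (size (comp 19 prelude_cmd 0) + size P, g).
Proof.
move=> [k [hk yE]]; rewrite /diagonal_program /switch.
set h := den prelude_cmd (init_config c).2.
(* Only register 20 may be nonzero after the prelude, so the registers from 20 on form an initial
   configuration for [P]. *)
have E : (0, fun r => h (20 + r)) = init_config (tower (unpack c) c).
  by rewrite /h den_prelude.
have H0 post := @comp_runs0 19 prelude_cmd post (init_config c).2
  erefl erefl erefl.
move: (comp _ _ _) H0 => pre H0.
have [g [Hg gE]] := runs_relocate P pre [:: Dec 20 (size pre + size P)] 20 k h.
rewrite E in Hg gE; exists g; split; first by rewrite -yE -gE addn0.
by rewrite (minn_idPr hk) in Hg; apply: runs_trans Hg; exact: H0.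
Qed.

Lemma halted_iter (Q : program) (c : config) (k m : nat) :
  halted Q (iter k (step Q) c) -> iter (m + k) (step Q) c = iter k (step Q) c.
Proof.
move=> hk; elim: m => // m IH; rewrite addSn iterS IH.
by move: hk; case: (iter k _ _) => pc f /= hk; rewrite onth_ge.
Qed.

Lemma diagonal_halts (P : program) (c : nat) :
  computes P (tower (unpack c) c) 1 ->
  exists k, halted (diagonal_program P)
    (iter k (step (diagonal_program P)) (init_config c)).
Proof.
move=> /diagonal_runs[g [g1]]; rewrite /diagonal_program.
move: (comp _ _ _) => pre [k kE]; exists k.+1.
by rewrite iterS kE /step onth_switch g1 /halted size_switch.
Qed.

Lemma diagonal_loops (P : program) (c : nat) :
  computes P (tower (unpack c) c) 0 ->
  forall k, ~~ halted (diagonal_program P)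
    (iter k (step (diagonal_program P)) (init_config c)).
Proof.
move=> /diagonal_runs[g [g0]]; rewrite /diagonal_program.
move: (comp _ _ _) => pre [k kE] n; set Q := switch pre P in kE *.
have fixed : step Q (size pre + size P, g) = (size pre + size P, g).
  by rewrite /step onth_switch g0.
(* A halted configuration would persist and so coincide with the fixed one, whose address lies
   inside the program. *)
apply/negP => hn; have := halted_iter k hn.
rewrite addnC iterD kE iter_fix // => E; move: hn; rewrite -E /halted.
by rewrite size_switch ltnn.
Qed.

End Programs.

(** * The game of a register program *)

Definition reg_of (i : instr) : nat :=
  match i with Inc r => r | Dec r _ => r end.

Definition nregs (T : program) : nat := (\max_(i <- T) reg_of i).+1.

Lemma reg_of_lt (T : program) (q : nat) (i : instr) :
  onth T q = Some i -> (reg_of i < nregs T)%N.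
Proof.
rewrite /nregs ltnS; elim: T q => [|i' T IH] [|q] //=.
  by move=> [->]; rewrite big_cons leq_maxl.
by move=> /IH H; rewrite big_cons; apply: (leq_trans H); exact: leq_maxr.
Qed.

(* The state is [size T].+1 control coordinates followed by two coordinates
   [2 ^ n] and [2 ^ - n] for each register. *)
Definition dim (T : program) : nat := ((size T).+1 + (nregs T).*2)%N.

(** Control coordinate [size T] stands for all addresses off the program. Both powers are kept so
    that tests can be checked linearly: [2 ^ n] is 1 at zero and at least 2 elsewhere, [2 * 2 ^ - n]
    is 2 at zero and at most 1 elsewhere. *)
Definition state_coef (T : program) (c : config) (j : nat) : rat :=
  if (j <= size T)%N then (j == minn c.1 (size T))%:R
  else let k := (j - (size T).+1)%N in
    if odd k then 2 ^- c.2 k./2 else 2 ^+ c.2 k./2.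

Definition state_vec (T : program) (c : config) : 'rV[rat]_(dim T) :=
  \row_j state_coef T c j.

(* The transition from [src] to [dst] multiplying [2 ^ n] by [s] for the
   register [r]. The last column is what Eve collects by a challenge: 2 for a
   wrong control state, and [ty * 2 ^ n + tx * 2 ^ - n] for the register [r]. *)
Definition move_coef (T : program) (src dst r : nat) (s ty tx : rat) (i j : nat)
    : rat :=
  if j == dim T then
    if (i <= size T)%N then 2 * (i != src)%:R
    else if i == ((size T).+1 + r.*2)%N then ty
    else if i == ((size T).+1 + r.*2).+1 then tx else 0
  else if (j <= size T)%N then ((i == src) && (j == dst))%:R
  else if i == j then
    let k := (j - (size T).+1)%N in
    if k./2 == r then (if odd k then s^-1 else s) else 1
  else 0.

(* Adam claims that the machine is at instruction [m.1] and, if it is a test,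
   that the register is zero iff [m.2]; off the program, he gives up. *)
Definition adam_coef (T : program) (m : nat * bool) (i j : nat) : rat :=
  match onth T m.1 with
  | None => if (j == dim T) && (i <= size T)%N then 2 else 0
  | Some (Inc r) => move_coef T m.1 m.1.+1 r 2 0 0 i j
  | Some (Dec r l) =>
      if m.2 then move_coef T m.1 (minn l (size T)) r 1 1 0 i j
      else move_coef T m.1 m.1.+1 r 2^-1 0 2 i j
  end.

Definition adam_mx (T : program) (m : nat * bool) : 'M[rat]_(dim T, (dim T).+1) :=
  \matrix_(i, j) adam_coef T m i j.

Definition continue_mx (T : program) : 'M[rat]_((dim T).+1, dim T) :=
  \matrix_(i, j) (i == j :> nat)%:R.

Definition challenge_mx (T : program) (c : nat) : 'M[rat]_((dim T).+1, dim T) :=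
  \matrix_(i, j) if i == dim T :> nat then state_coef T (init_config c) j else 0.

(** The index [size T], off the program, gives the matrix by which Adam gives up. *)
Definition moves (T : program) : seq (nat * bool) :=
  [seq (q, b) | q <- iota 0 (size T).+1, b <- [:: true; false]].

Definition game (T : program) (c : nat) : mmg_instance :=
  @MMGInstance (dim T) (dim T).+1 [seq adam_mx T m | m <- moves T]
    [:: continue_mx T; challenge_mx T c] 1.

(** * The effect of one round on a state *)

Lemma sum_ord_delta (V : nmodType) (n k : nat) (F : nat -> V) : (k < n)%N ->
  \sum_(i < n) (if (i : nat) == k then F i else 0) = F k.
Proof.
move=> kn; rewrite -big_mkcond (@big_pred1 _ _ _ _ (Ordinal kn)) //.
Qed.

Lemma mulmx_continue (T : program) (m : nat * bool) (v : 'rV[rat]_(dim T)) :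
  v *m (adam_mx T m *m continue_mx T) =
  \row_j \sum_i v 0 i * adam_coef T m i j.
Proof.
apply/rowP => j; rewrite mulmxA mxE [RHS]mxE.
pose F (k : nat) := \sum_i v 0 i * adam_coef T m i k.
rewrite -[RHS]/(F j) -(@sum_ord_delta _ (dim T).+1 j F); last first.
  by rewrite ltnW // ltnS.
apply: eq_bigr => k _; rewrite !mxE; case: eqP => _; last by rewrite mulr0.
by rewrite mulr1; apply: eq_bigr => i _; rewrite mxE.
Qed.

Lemma mulmx_challenge (T : program) (c : nat) (m : nat * bool)
    (v : 'rV[rat]_(dim T)) :
  v *m (adam_mx T m *m challenge_mx T c) =
  (\sum_i v 0 i * adam_coef T m i (dim T)) *: state_vec T (init_config c).
Proof.
apply/rowP => j; rewrite mulmxA mxE [RHS]mxE.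
pose F (k : nat) := (\sum_i v 0 i * adam_coef T m i k) *
  state_coef T (init_config c) j.
rewrite [state_vec _ _ _ _]mxE -[RHS]/(F (dim T)).
rewrite -(@sum_ord_delta _ (dim T).+1 (dim T) F) //.
apply: eq_bigr => k _; rewrite !mxE; case: eqP => _; last by rewrite mulr0.
by congr (_ * _); apply: eq_bigr => i _; rewrite mxE.
Qed.

Lemma state_coef_value (T : program) (c : config) (r : nat) :
  state_coef T c ((size T).+1 + r.*2) = 2 ^+ c.2 r /\
  state_coef T c ((size T).+1 + r.*2).+1 = 2 ^- c.2 r.
Proof.
rewrite /state_coef -addnS; split.
  by rewrite leqNgt ltn_addr //= addKn odd_double doubleK.
by rewrite leqNgt ltn_addr //= addKn /= odd_double /= uphalf_double.
Qed.

Lemma state_coef_ge0 (T : program) (c : config) (j : nat) :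
  0 <= state_coef T c j.
Proof.
rewrite /state_coef; case: ifP => _; first exact: ler0n.
by case: ifP => _; rewrite ?invr_ge0 exprn_ge0.
Qed.

Lemma control_lt_dim (T : program) (q : nat) : (q <= size T)%N -> (q < dim T)%N.
Proof. by move=> qT; rewrite /dim ltn_addr. Qed.

(** At most three terms survive, at the current control coordinate and at the two coordinates of
    [r]; each is written as a delta sum and the sums are compared termwise. *)
Lemma challenge_move (T : program) (c : config) (src dst r : nat) (s ty tx : rat) :
  (r < nregs T)%N ->
  \sum_(i < dim T) state_vec T c 0 i * move_coef T src dst r s ty tx i (dim T) =
  2 * (minn c.1 (size T) != src)%:R + ty * 2 ^+ c.2 r + tx * 2 ^- c.2 r.
Proof.
move=> rT; pose p := minn c.1 (size T).
pose y := ((size T).+1 + r.*2)%N.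
have yT : (y.+1 < dim T)%N.
  by rewrite /y /dim -addnS -addnS -doubleS leq_add2l leq_double.
have pT : (p <= size T)%N by exact: geq_minr.
rewrite -(sum_ord_delta (fun=> 2 * (p != src)%:R) (control_lt_dim pT)).
rewrite -(sum_ord_delta (fun=> ty * 2 ^+ c.2 r) (ltnW yT)).
rewrite -(sum_ord_delta (fun=> tx * 2 ^- c.2 r) yT).
rewrite -!big_split /=; apply: eq_bigr => i _.
have [Ey Ex] := state_coef_value T c r.
rewrite mxE /move_coef eqxx -/y.
have [iT|Ti] := leqP i (size T).
  have [iy ix] : (i == y :> nat) = false /\ (i == y.+1 :> nat) = false.
    by split; apply/eqP; rewrite /y; lia.
  rewrite iy ix !addr0 /state_coef iT -/p.
  by case: eqP => [->|_]; rewrite ?mul1r ?mul0r.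
have ip : (i == p :> nat) = false by apply/eqP; lia.
rewrite ip add0r; have [iy|iy] := eqVneq (i : nat) y.
  by rewrite iy Ey ltn_eqF // addr0 mulrC.
by have [ix|ix] := eqVneq (i : nat) y.+1; rewrite add0r ?ix ?Ex ?mulr0 // mulrC.
Qed.

(** Stating the update of [r] through powers of 2 covers increments, zero tests and decrements at
    once. *)
Lemma continue_move (T : program) (c : config) (src dst r : nat) (s ty tx : rat)
    (f' : nat -> nat) :
  (src <= size T)%N -> minn c.1 (size T) = src -> (dst <= size T)%N ->
  2 ^+ f' r = 2 ^+ c.2 r * s -> (forall t, t != r -> f' t = c.2 t) ->
  \row_(j < dim T)
    (\sum_i state_vec T c 0 i * move_coef T src dst r s ty tx i j) =
  state_vec T (dst, f').
Proof.
move=> srcT pE dstT f's f'E; apply/rowP => j; rewrite !mxE.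
have jT : (j == dim T :> nat) = false by rewrite ltn_eqF.
rewrite /move_coef jT; have [le_jT|Tj] := leqP j (size T).
  pose F := (fun i : nat => ((j : nat) == dst)%:R : rat).
  rewrite [RHS]/state_coef le_jT /= (minn_idPl dstT).
  rewrite -[RHS]/(F src) -(sum_ord_delta F (control_lt_dim srcT)).
  apply: eq_bigr => i _; rewrite mxE /state_coef pE /F.
  case: (eqVneq (i : nat) src) => [->|_] /=; last by rewrite mulr0.
  by rewrite srcT mul1r.
pose k := (j - (size T).+1)%N.
pose F (i : nat) := state_coef T c i *
  (if k./2 == r then (if odd k then s^-1 else s) else 1).
transitivity (F j).
  rewrite -(sum_ord_delta F (ltn_ord j)); apply: eq_bigr => i _.
  by rewrite mxE; case: eqP => _; rewrite ?mulr0.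
rewrite /F /state_coef leqNgt Tj /= -/k; case: eqP => [->|/eqP kr].
  by rewrite f's; case: ifP => _ //; rewrite invfM.
by rewrite mulr1 f'E.
Qed.

(** The honest claim works: a challenge then collects 0 at an increment, [2 ^ 0 = 1] at a zero
    register, and [2 * 2 ^ - n <= 1] at a register of content [n > 0]. *)
Lemma game_followed (T : program) (w : nat) (c : config) : ~~ halted T c ->
  exists2 m, m \in moves T &
    state_vec T c *m (adam_mx T m *m continue_mx T) = state_vec T (step T c) /\
    exists2 a, 0 <= a <= 1 &
      state_vec T c *m (adam_mx T m *m challenge_mx T w)
        = a *: state_vec T (init_config w).
Proof.
case: c => pc f; rewrite /halted -ltnNge /= => pcT.
have pT : minn pc (size T) = pc by apply/minn_idPl/ltnW.
have mT b : (pc, b) \in moves T.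
  apply/allpairsP; exists (pc, b); split; [|by case: b|by []].
  by rewrite mem_iota add0n leq0n ltnS ltnW.
have [[r|r l] iE] := onth_lt pcT; have /= rT := reg_of_lt iE.
- exists (pc, true) => //; rewrite mulmx_continue mulmx_challenge.
  rewrite /adam_coef iE; split.
    apply: continue_move; rewrite ?(ltnW pcT) //= ?set_reg_eq ?exprSr //.
    by move=> t tr; rewrite set_reg_neq.
  exists 0; rewrite ?lexx ?ler01 //; congr (_ *: _).
  by rewrite challenge_move //= pT eqxx !mul0r mulr0 !addr0.
- have [f0|f0] := eqVneq (f r) 0%N.
    exists (pc, true) => //; rewrite mulmx_continue mulmx_challenge.
    rewrite /adam_coef iE /=; split.
      rewrite (@continue_move _ _ _ _ _ _ _ _ f) ?(ltnW pcT) ?geq_minr ?mulr1 //=.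
      by apply/rowP => j; rewrite !mxE /state_coef f0 /= -minnA minnn.
    exists 1; rewrite ?ler01 ?lexx //; congr (_ *: _).
    by rewrite challenge_move //= pT eqxx f0 expr0 mul0r !mulr0 mulr1 add0r addr0.
  exists (pc, false) => //; rewrite mulmx_continue mulmx_challenge.
  have f1 : (f r).-1.+1 = f r by rewrite prednK // lt0n.
  rewrite /adam_coef iE (negbTE f0) /=; split.
    apply: continue_move; rewrite ?(ltnW pcT) //= ?set_reg_eq.
      by rewrite -{2}f1 exprSr mulfK.
    by move=> t tr; rewrite set_reg_neq.
  exists (2 * 2 ^- f r); last first.
    by congr (_ *: _); rewrite challenge_move //= pT eqxx !mul0r mulr0 !add0r.
  rewrite mulr_ge0 ?invr_ge0 ?exprn_ge0 //= ler_pdivrMr ?exprn_gt0 // mul1r.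
  by rewrite -f1 exprS ler_peMr // exprn_ege1 // ler1n.
Qed.

Lemma onth_Some_lt (T : Type) (s : seq T) (i : nat) (x : T) :
  onth s i = Some x -> (i < size s)%N.
Proof. by move=> H; rewrite ltnNge; apply/negP => /onth_ge; rewrite H. Qed.

Lemma challenge_restart (T : program) (m : nat * bool) (v : 'rV[rat]_(dim T)) :
  onth T m.1 = None ->
  \sum_i v 0 i * adam_coef T m i (dim T) =
  2 * \sum_(i < dim T) (if (i <= size T)%N then v 0 i else 0).
Proof.
move=> mE; rewrite mulr_sumr; apply: eq_bigr => i _.
by rewrite /adam_coef mE eqxx /=; case: ifP; rewrite ?mulr0 // mulrC.
Qed.

Lemma sum_control (T : program) (c : config) :
  \sum_(i < dim T) (if (i <= size T)%N then state_vec T c 0 i else 0) = 1.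
Proof.
have pT : (minn c.1 (size T) < dim T)%N by rewrite control_lt_dim ?geq_minr.
rewrite -[RHS](sum_ord_delta (fun=> 1) pT); apply: eq_bigr => i _.
rewrite mxE /state_coef; case: ifP => [iT|]; first by rewrite ?iT; case: eqP.
by case: eqP => // ->; rewrite geq_minr.
Qed.

(** A challenge collects at least 2 from a wrong control state, 2 from giving up, [2 ^ n >= 2] from
    a false claim of zero, and [2 * 2 ^ 0] from a false claim of nonzero. *)
Lemma game_answered (T : program) (w : nat) (c : config) (m : nat * bool) :
  (~~ halted T c /\
    state_vec T c *m (adam_mx T m *m continue_mx T) = state_vec T (step T c)) \/
  exists2 a, 2 <= a &
    state_vec T c *m (adam_mx T m *m challenge_mx T w)
      = a *: state_vec T (init_config w).
Proof.
rewrite mulmx_continue mulmx_challenge.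
case mE : (onth T m.1) => [i|]; last first.
  by right; exists 2 => //; rewrite challenge_restart // sum_control mulr1.
have mT := onth_Some_lt mE; have rT := reg_of_lt mE.
have pow0 n : 0 <= 2 ^+ n :> rat by rewrite exprn_ge0.
have inv0 n : 0 <= 2 ^- n :> rat by rewrite invr_ge0.
(* A halted state has control coordinate [size T], hence is caught here as well, because
   [m.1 < size T]. *)
have [pE|pE] := eqVneq (minn c.1 (size T)) m.1; last first.
  right; eexists; last reflexivity.
  rewrite /adam_coef mE; case: i mE rT => [r|r l] mE /= rT.
    by rewrite challenge_move // pE !mul0r !addr0 mulr1.
  case: (m.2); rewrite challenge_move // pE mulr1 -addrA lerDl addr_ge0 //;
    by rewrite mulr_ge0.
case: c pE => pc f /= pE.
have pcT : (pc < size T)%N by move: mT; rewrite -pE gtn_min ltnn orbF.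
have {}pE : pc = m.1 by rewrite -pE (minn_idPl (ltnW pcT)).
subst pc; have pT : minn m.1 (size T) = m.1 by apply/minn_idPl/ltnW.
rewrite /halted -ltnNge pcT /step mE /adam_coef mE.
case: i mE rT => [r|r l] mE /= rT.
  left; split => //; apply: continue_move; rewrite ?(ltnW pcT) //=.
    by rewrite set_reg_eq exprSr.
  by move=> t tr; rewrite set_reg_neq.
case: (m.2); have [f0|f0] := eqVneq (f r) 0%N.
- left; split => //.
  rewrite (@continue_move _ _ _ _ _ _ _ _ f) ?(ltnW pcT) ?geq_minr ?mulr1 //=.
  by apply/rowP => j; rewrite !mxE /state_coef /= -minnA minnn.
- right; eexists; last reflexivity.
  rewrite challenge_move //= pT eqxx mulr0 mul0r add0r addr0 mul1r.
  by rewrite -(prednK (n := f r)) ?lt0n // exprS ler_peMr // exprn_ege1 // ler1n.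
- right; eexists; last reflexivity.
  by rewrite challenge_move //= pT eqxx mulr0 mul0r !add0r f0 expr0 invr1 mulr1.
- left; split => //; apply: continue_move; rewrite ?(ltnW pcT) //=.
    by rewrite set_reg_eq -{2}(prednK (n := f r)) ?lt0n // exprSr mulfK.
  by move=> t tr; rewrite set_reg_neq.
Qed.

(** Stated for every row [v], since Adam's opening restart is applied to the all-one row. *)
Lemma game_restarted (T : program) (w : nat) :
  exists2 m, m \in moves T &
    (forall v : 'rV[rat]_(dim T), v *m (adam_mx T m *m continue_mx T) = 0) /\
    (forall v : 'rV[rat]_(dim T), v *m (adam_mx T m *m challenge_mx T w) =
      (2 * \sum_(i < dim T) (if (i <= size T)%N then v 0 i else 0))
        *: state_vec T (init_config w)).
Proof.
exists (size T, true).
  apply/allpairsP; exists (size T, true); split => //.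
  by rewrite mem_iota add0n leq0n ltnSn.
have mE : onth T (size T, true).1 = None by exact: onth_ge.
split=> v; last by rewrite mulmx_challenge challenge_restart.
rewrite mulmx_continue; apply/rowP => j; rewrite !mxE big1 // => i _.
by rewrite /adam_coef mE ltn_eqF //= mulr0.
Qed.

(** * Transfer to the reals and the value of the game *)

Lemma mxle_ratr (R : numFieldType) (m n : nat) (X Y : 'M[rat]_(m, n)) :
  mxle X Y -> mxle (map_mx (ratr : rat -> R) X) (map_mx ratr Y).
Proof. by move=> XY i j; rewrite !mxE ler_rat. Qed.

Lemma state_vec_ge0 (T : program) (c : config) : mxle 0 (state_vec T c).
Proof. by move=> i j; rewrite !mxE; exact: state_coef_ge0. Qed.

Lemma state_vecZ_le (T : program) (c : config) (a b : rat) : a <= b ->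
  mxle (a *: state_vec T c) (b *: state_vec T c).
Proof. by move=> ab i j; rewrite !mxE ler_wpM2r ?state_coef_ge0. Qed.

Lemma mass_state_vec (T : program) (c : config) : 1 <= mass (state_vec T c).
Proof.
rewrite -[X in X <= _](sum_control T c); apply: ler_sum => i _.
by case: ifP => // _; rewrite mxE state_coef_ge0.
Qed.

Lemma adam_mx_ge0 (T : program) (m : nat * bool) (i : 'I_(dim T))
    (j : 'I_(dim T).+1) : 0 <= adam_mx T m i j.
Proof.
have H src dst r s ty tx : 0 <= s -> 0 <= ty -> 0 <= tx ->
    0 <= move_coef T src dst r s ty tx i j.
  move=> s0 ty0 tx0; rewrite /move_coef; case: ifP => _.
    by case: ifP => _; [rewrite mulr_ge0|case: ifP => _ //; case: ifP].
  by do 4 (case: ifP => _ //); rewrite invr_ge0.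
rewrite mxE /adam_coef; case: onth => [[r|r l]|].
- exact: H.
- by case: ifP => _; apply: H.
- by case: ifP.
Qed.

Lemma eve_mx_ge0 (T : program) (w : nat) (i : 'I_(dim T).+1) (j : 'I_(dim T)) :
  0 <= continue_mx T i j /\ 0 <= challenge_mx T w i j.
Proof.
by split; rewrite mxE //; case: ifP => // _; exact: state_coef_ge0.
Qed.

Definition orbit (T : program) (w j : nat) : config :=
  iter j (step T) (init_config w).

Definition real_state (R : realType) (T : program) (w j : nat) : 'rV[R]_(dim T) :=
  map_mx ratr (state_vec T (orbit T w j)).

Lemma real_state_ge0 (R : realType) (T : program) (w j : nat) :
  mxle 0 (real_state R T w j).
Proof. by have := @mxle_ratr R _ _ _ _ (@state_vec_ge0 T (orbit T w j)); rewrite map_mx0. Qed.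

Lemma game_adam_ge0 (R : realType) (T : program) (w : nat) X :
  adam_set R (game T w) X -> mxle 0 X.
Proof.
move=> [Y /mapP[m _ ->] <-] i j.
by rewrite !mxE ler0q; have := adam_mx_ge0 m i j; rewrite mxE.
Qed.

Lemma game_eve_ge0 (R : realType) (T : program) (w : nat) X :
  eve_set R (game T w) X -> mxle 0 X.
Proof.
move=> [Y YE <-] i j; rewrite mxE [X in _ <= X]mxE ler0q.
have [H0 H1] := eve_mx_ge0 w i j; move: YE => /=.
by rewrite !inE => /orP[]/eqP ->.
Qed.

Lemma ratr_mulmx (R : realType) (m n p q : nat) (v : 'M[rat]_(m, n))
    (X : 'M[rat]_(n, p)) (Y : 'M[rat]_(p, q)) :
  map_mx (ratr : rat -> R) v *m (map_mx ratr X *m map_mx ratr Y) =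
  map_mx ratr (v *m (X *m Y)).
Proof. by rewrite !map_mxM. Qed.

Lemma game_upper_value (R : realType) (T : program) (w l : nat) (r : R) :
  1 <= r -> r ^+ l.+1 = 2 -> (forall j, (j < l)%N -> ~~ halted T (orbit T w j)) ->
  (upper_value (adam_set R (game T w)) (eve_set R (game T w)) <= r%:E)%E.
Proof.
move=> r1 rl run; have [m0 m0T [cont0 chal0]] := game_restarted T w.
have AX m : m \in moves T -> adam_set R (game T w) (map_mx ratr (adam_mx T m)).
  by move=> mT; exists (adam_mx T m) => //; exact: (map_f (adam_mx T)).
(* What a challenge collects when Adam gives up on the all-one row. *)
pose S : rat := 2 * \sum_(i < dim T) (if (i <= size T)%N then
  (const_mx 1 : 'rV[rat]_(dim T)) 0 i else 0).
have S0 : 0 <= S.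
  by rewrite mulr_ge0 // sumr_ge0 // => i _; rewrite mxE; case: ifP.
apply: (@upper_value_le R _ _ _ _ (real_state R T w) l r (ratr S)) => //.
- exact: game_adam_ge0.
- exact: game_eve_ge0.
- exact: real_state_ge0.
- by rewrite ler0q.
- move=> j jl; have [m mT [contE [a /andP[a0 a1] chalE]]] := game_followed w (run j jl).
  exists (map_mx ratr (adam_mx T m)); first exact: AX.
  move=> _ [Y /= YE <-]; move: YE; rewrite !inE ratr_mulmx => /orP[]/eqP ->.
    by left; rewrite contE.
  right; rewrite chalE; apply: mxle_ratr.
  by rewrite -[X in mxle _ X]scale1r; exact: state_vecZ_le.
- exists (map_mx ratr (adam_mx T m0)); first exact: AX.
  move=> _ [Y /= YE <-].
  have -> : const_mx 1 = map_mx (ratr : rat -> R) (const_mx 1 : 'rV[rat]_(dim T)).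
    by rewrite map_const_mx rmorph1.
  rewrite -(ratr_nat R 2) !ratr_mulmx -!map_mxZ.
  have Z a v : 0 <= a -> mxle 0 (a *: state_vec T v) by move=> a0 i j; rewrite !mxE mulr_ge0 ?state_coef_ge0.
  move: YE; rewrite !inE => /orP[]/eqP ->; rewrite ?cont0 ?chal0; split; apply: mxle_ratr.
  + exact: Z.
  + exact: Z.
  + by [].
  + by rewrite sum_control mulr1.
Qed.

Lemma game_lower_value (R : realType) (T : program) (w : nat) (r : R) : 1 <= r ->
  (forall j, (forall i, (i < j)%N -> ~~ halted T (orbit T w i)) -> r ^+ j.+1 <= 2) ->
  (r%:E <= lower_value (adam_set R (game T w)) (eve_set R (game T w)))%E.
Proof.
move=> r1 rP.
have EX Y : Y \in eve_matrices (game T w) -> eve_set R (game T w) (map_mx ratr Y).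
  by move=> YE; exists Y.
(* The invariant says that [T] has not halted before step [j]; it bounds the length of a run that
   Adam can follow. *)
apply: (@lower_value_ge R _ _ _ _ (real_state R T w)
  (fun j => forall i, (i < j)%N -> ~~ halted T (orbit T w i)) r) => //.
- have [m mT _] := game_restarted T w.
  by exists (map_mx ratr (adam_mx T m)), (adam_mx T m) => //; exact: (map_f (adam_mx T)).
- exact: game_adam_ge0.
- exact: game_eve_ge0.
- exact: real_state_ge0.
- move=> j; have := mass_state_vec T (orbit T w j).
  rewrite -(ler_rat R) rmorph1 /mass rmorph_sum /=.
  by under [X in _ -> _ <= X]eq_bigr do rewrite mxE.
- move=> j _ run [X /mapP[m mT ->] <-].
  have [[nh contE]|[a a2 chalE]] := @game_answered T w (orbit T w j) m.
    exists (map_mx ratr (continue_mx T)); first by apply: EX; rewrite inE eqxx.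
    left; rewrite ratr_mulmx contE; split => // i.
    by rewrite ltnS leq_eqVlt => /predU1P[->|/run].
  exists (map_mx ratr (challenge_mx T w)).
    by apply: EX; rewrite !inE eqxx orbT.
  right; rewrite ratr_mulmx chalE -(ratr_nat R 2) -map_mxZ; apply: mxle_ratr.
  exact: state_vecZ_le.
Qed.

Lemma root2_ge1 (R : realType) (l : nat) : 1 <= (2 : R) `^ (l.+1%:R)^-1.
Proof. by rewrite -[X in X <= _](powRr0 (2 : R)) ler_powR ?invr_ge0 // ler1n. Qed.

Lemma root2X (R : realType) (l : nat) : ((2 : R) `^ (l.+1%:R)^-1) ^+ l.+1 = 2.
Proof.
by rewrite -powR_mulrn ?powR_ge0 // -powRrM mulVf ?pnatr_eq0 // powRr1.
Qed.

Lemma game_halting (R : realType) (T : program) (w : nat) :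
  (exists k, halted T (orbit T w k)) ->
  exists2 r : R, 1 < r &
    determined_with_value (adam_set R (game T w)) (eve_set R (game T w)) r%:E.
Proof.
move=> H; have [k hk kmin] := ex_minnP H.
pose r : R := 2 `^ (k.+1%:R)^-1; have r1 : 1 <= r := root2_ge1 R k.
have r2 : r ^+ k.+1 = 2 := root2X R k.
have run j : (j < k)%N -> ~~ halted T (orbit T w j).
  by move=> jk; apply/negP => /kmin; rewrite leqNgt jk.
exists r.
  rewrite lt_neqAle r1 andbT; apply/eqP => r1E.
  by move: r2; rewrite -r1E expr1n => /eqP; rewrite (eqr_nat R 1 2).
have up := game_upper_value r1 r2 run.
have lo : (r%:E <= lower_value (adam_set R (game T w)) (eve_set R (game T w)))%E.
  (* Since [T] halts at step [k], the invariant forces [j <= k]. *)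
  apply: game_lower_value => // j jP; rewrite -r2 ler_weXn2l // ltnS leqNgt.
  by apply/negP => /jP; rewrite hk.
have du := lower_value_le_upper_value (adam_set R (game T w)) (eve_set R (game T w)).
split; apply/eqP; rewrite eq_le; apply/andP; split => //.
- exact: le_trans lo du.
- exact: le_trans du up.
Qed.

Lemma game_nonhalting (R : realType) (T : program) (w : nat) :
  (forall k, ~~ halted T (orbit T w k)) ->
  determined_with_value (adam_set R (game T w)) (eve_set R (game T w)) 1%:E.
Proof.
move=> run; set A := adam_set _ _; set E := eve_set _ _.
have up : (upper_value A E <= 1%:E)%E.
  (* The bounds [2 ^ (1 / (l + 1))], one for each number [l] of honest rounds, tend to 1. *)
  have C := @cvg_root_geometric R 2 1 (ltr0Sn R 1) ltr01.
  rewrite -(cvg_lim _ C) //; apply: lime_ge; first by apply/cvg_ex; eexists; exact: C.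
  apply: nearW => l; rewrite expr1n mulr1.
  by apply: game_upper_value => //; [exact: root2_ge1|exact: root2X].
have lo : (1%:E <= lower_value A E)%E.
  by apply: game_lower_value => // j _; rewrite expr1n ler1n.
have du := lower_value_le_upper_value A E.
split; apply/eqP; rewrite eq_le; apply/andP; split => //.
- exact: le_trans lo du.
- exact: le_trans du up.
Qed.

(** Determinacy is only a proposition, so excluded middle may settle whether [T] halts. *)
Lemma game_admissible (R : realType) (T : program) (w : nat) :
  admissible R (game T w).
Proof.
split=> //.
- split=> X; first by move=> /mapP[m _ ->] i j; exact: adam_mx_ge0.
  rewrite !inE => H i j; have [H0 H1] := eve_mx_ge0 w i j.
  by case/orP: H => /eqP ->.
- have [H|H] := pselect (exists k, halted T (orbit T w k)).
    by have [r _ V] := game_halting R H; exists r%:E.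
  exists 1%:E; apply: game_nonhalting => k.
  by apply/negP => hk; apply: H; exists k.
Qed.

Lemma game_value_le (R : realType) (T : program) (w : nat) :
  value_le_threshold R (game T w) <-> forall k, ~~ halted T (orbit T w k).
Proof.
split=> [[V [VE _] V1] k|H]; last first.
  by exists 1%:E; [exact: game_nonhalting|rewrite /= rmorph1].
apply/negP => hk; have [r r1 [rE _]] := game_halting R (ex_intro _ k hk).
by move: V1; rewrite -VE rE /= rmorph1 lee_fin leNgt r1.
Qed.

(** * The code of the game *)

(** [code (x :: s)] is [2 ^ x * (2 * code s + 1)], and affine maps compose. *)
Lemma code_cat (p : seq nat) : exists a b : nat, forall s,
  CodeSeq.code (p ++ s) = (a + b * CodeSeq.code s)%N.
Proof.
elim: p => [|x p [a [b IH]]]; first by exists 0%N, 1%N => s; rewrite mul1n.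
exists (2 ^ x * a.*2.+1)%N, (2 ^ x * b.*2)%N => s.
rewrite /= -/(CodeSeq.code (p ++ s)) IH -mulnA -mulnDr -doubleMl; congr muln.
lia.
Qed.

Lemma code_cat_cons (p s : seq nat) : exists a b : nat, forall y,
  CodeSeq.code (p ++ y :: s) = (a + b * 2 ^ y)%N.
Proof.
have [a [b H]] := code_cat p.
exists a, (b * (CodeSeq.code s).*2.+1)%N => y.
by rewrite H /= mulnA mulnAC.
Qed.

(** The numerator or denominator [2 ^ c] becomes an exponent in the code, whence affine functions of
    [2 ^ 2 ^ c]. *)
Lemma rat_code_pow2 (c : nat) :
  rat_code (2 ^+ c) = (10 * 2 ^ 2 ^ c).+1 /\
  rat_code (2 ^- c) = (8 * 2 ^ 2 ^ c + 5)%N.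
Proof.
have E : 2 ^+ c = ((2 ^ c)%N%:Z)%:~R :> rat by rewrite -pmulrn natrX.
have pos : (0 < 2 ^ c)%N by rewrite expn_gt0.
split.
  have -> : rat_code (2 ^+ c) = CodeSeq.code [:: 0; 2 ^ c; 1]%N.
    by rewrite /rat_code ltNge exprn_ge0 //= E numq_int denq_int.
  by rewrite /=; lia.
have -> : rat_code (2 ^- c) = CodeSeq.code [:: 0; 1; 2 ^ c]%N.
  have nz : (2 ^ c)%N%:Z != 0 by rewrite eqz_nat -lt0n.
  rewrite /rat_code ltNge invr_ge0 exprn_ge0 //= E denqVz //.
  rewrite -[X in numq X]mul1r -[X in X / _](rmorph1 intr) coprimeq_num ?coprime1n //.
  by rewrite gtr0_sg.
by rewrite /=; lia.
Qed.

Lemma map_enum_ord (U : Type) (n : nat) (F : nat -> U) :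
  [seq F (nat_of_ord i) | i <- enum 'I_n] = [seq F i | i <- iota 0 n].
Proof. by rewrite -val_enum_ord -map_comp. Qed.

Lemma challenge_row_code (T : program) : exists a b e : nat, forall w,
  CodeSeq.code [seq rat_code (state_coef T (init_config w) j)
               | j <- iota 0 (dim T)] =
  (a + b * 2 ^ (10 * 2 ^ 2 ^ w) + e * 2 ^ (18 * 2 ^ 2 ^ w))%N.
Proof.
pose F w j := rat_code (state_coef T (init_config w) j).
pose S := (size T).+1; pose n := (\max_(i <- T) reg_of i).*2.
pose p := [seq F 0%N j | j <- iota 0 S]; pose s := [seq F 0%N j | j <- iota S.+2 n].
have FE w j : j != S -> j != S.+1 -> F w j = F 0%N j.
  move=> jS jS1; rewrite /F /state_coef; case: leqP => // Sj.
  (* Off the two coordinates of register 0, the registers start at 0 whatever [w] is. *)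
  suff -> : (init_config w).2 (j - (size T).+1)./2 = 0%N.
    by rewrite /= if_same.
  rewrite /init_config /=; case: eqP => // k0.
  have : (j - S < 2)%N by rewrite -[(j - S)%N]odd_double_half /S k0; case: odd.
  by move: jS jS1 Sj; rewrite /S; lia.
have FS w : F w S = (10 * 2 ^ 2 ^ w).+1.
  have [<- _] := rat_code_pow2 w.
  by rewrite /F /S; have [] := state_coef_value T (init_config w) 0; rewrite double0 addn0 => ->.
have FS1 w : F w S.+1 = (8 * 2 ^ 2 ^ w + 5)%N.
  have [_ <-] := rat_code_pow2 w.
  by rewrite /F /S; have [_] := state_coef_value T (init_config w) 0; rewrite double0 addn0 => ->.
have [a [b ab]] := code_cat p.
(* With entries [10 * d + 1] and [8 * d + 5], the constants are [2 ^ 1] and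
   [2 ^ 1 * 2 * 2 ^ 5 = 128]. *)
exists a, (2 * b)%N, (128 * b * (CodeSeq.code s).*2.+1)%N => w.
have -> : [seq F w j | j <- iota 0 (dim T)] = p ++ [:: F w S, F w S.+1 & s].
  rewrite /dim /nregs doubleS -/S -/n -addn2 (addnC n) iotaD map_cat add0n.
  congr cat; first by apply/eq_in_map => j; rewrite mem_iota => jS; apply: FE; lia.
  rewrite /=; congr [:: _, _ & _].
  by apply/eq_in_map => j; rewrite mem_iota => jS; apply: FE; lia.
rewrite ab FS FS1 [CodeSeq.code _]/= -/(CodeSeq.code s); set d := (2 ^ 2 ^ w)%N.
have -> : (18 * d = 10 * d + 8 * d)%N by lia.
rewrite expnS !expnD; move: (2 ^ (10 * d))%N (2 ^ (8 * d))%N => u v.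
by rewrite -!mul2n; ring.
Qed.

Lemma game_code (T : program) : exists a0 b0 e0 a1 b1 a2 b2 a3 b3 : nat,
  forall w, mmg_code (game T w) = tower [:: a0; b0; e0; a1; b1; a2; b2; a3; b3] w.
Proof.
have [a0 [b0 [e0 H0]]] := challenge_row_code T.
pose zero_rows : seq nat := [seq CodeSeq.code [seq rat_code 0 | _ <- iota 0 (dim T)]
  | _ <- iota 0 (dim T)].
have [a1 [b1 H1]] := code_cat_cons zero_rows [::].
have [a2 [b2 H2]] := code_cat_cons [:: mx_code (continue_mx T)] [::].
have [a3 [b3 H3]] := code_cat_cons [:: dim T; (dim T).+1;
  CodeSeq.code [seq mx_code X | X <- [seq adam_mx T m | m <- moves T]]]
  [:: rat_code 1].
have mxE w : mx_code (challenge_mx T w) = CodeSeq.code (zero_rows ++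
    [:: CodeSeq.code [seq rat_code (state_coef T (init_config w) j)
                     | j <- iota 0 (dim T)]]).
  pose G i := CodeSeq.code [seq rat_code (if i == dim T then
    state_coef T (init_config w) j else 0) | j <- iota 0 (dim T)].
  transitivity (CodeSeq.code [seq G (nat_of_ord i) | i <- enum 'I_(dim T).+1]).
    congr CodeSeq.code; apply: eq_map => i; rewrite /G; congr CodeSeq.code.
    rewrite -(@map_enum_ord _ _ (fun j => rat_code (if i == dim T :> nat then
      state_coef T (init_config w) j else 0))).
    by apply: eq_map => j; rewrite mxE.
  rewrite map_enum_ord -addn1 iotaD map_cat add0n; congr CodeSeq.code; congr cat.
    by apply/eq_in_map => i; rewrite mem_iota /G => iT; rewrite ltn_eqF.
  by rewrite /= /G eqxx.
exists a0, b0, e0, a1, b1, a2, b2, a3, b3 => w.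
have -> : mmg_code (game T w) = CodeSeq.code ([:: dim T; (dim T).+1;
    CodeSeq.code [seq mx_code X | X <- [seq adam_mx T m | m <- moves T]]] ++
    CodeSeq.code ([:: mx_code (continue_mx T)] ++ mx_code (challenge_mx T w) :: [::])
    :: [:: rat_code 1]) by [].
by rewrite H3 H2 mxE H1 H0.
Qed.

Theorem theorem2 (R : realType) :
  undecidable mmg_code (admissible R) (value_le_threshold R).
Proof.
move=> [P decP]; set T := diagonal_program P.
have [a0 [b0 [e0 [a1 [b1 [a2 [b2 [a3 [b3 codeE]]]]]]]]] := game_code T.
(* No circularity: [T] depends on [P] alone and reads the coefficients of its own game from its
   input [c], chosen afterwards. *)
have [c cE] := unpack_surj a0 b0 e0 a1 b1 a2 b2 a3 b3.
have [yes no] := decP (game T c) (game_admissible R T c).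
rewrite codeE -cE in yes no.
(* On input [c], [T] consults [P] about [game T c] and does the opposite of what the answer says
   about halting. *)
have [V1|V1] := pselect (value_le_threshold R (game T c)).
  have [k hk] := diagonal_halts (yes V1).
  by move/game_value_le: V1 => /(_ k); rewrite /orbit hk.
by apply: (V1); apply/game_value_le; exact: diagonal_loops (no V1).
Qed.
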